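(* Let $\hat{\mathcal{G}}$ be the profinite completion of the Grigorchuk group $\mathcal{G}$. Then $H^2(\hat{\mathcal{G}},\mathbb{F}_2)\cong (C_2)^\infty$, the direct sum of countably infinitely many copies of $C_2$, and hence $\hat{\mathcal{G}}$ is not finitely presented as a profinite group.
   Context: Let $X=\{0,1\}$ and let $X^*$ be the set of finite words over $X$, viewed as the binary rooted tree (the root is the empty word, and the children of $w$ are $w0,w1$). The Grigorchuk group $\mathcal{G}\le \mathrm{Aut}(X^* )$ is the group generated by the tree automorphisms $a,b,c,d$ defined recursively for $w\in X^*$ by: $a(0w)=1w$, $a(1w)=0w$; $b(0w)=0\,a(w)$, $b(1w)=1\,c(w)$; $c(0w)=0\,a(w)$, $c(1w)=1\,d(w)$; $d(0w)=0w$, $d(1w)=1\,b(w)$ (all fix the empty word). $H^2(\hat{\mathcal{G}},\mathbb{F}_2)$ denotes continuous (profinite group) cohomology with trivial coefficients in the field $\mathbb{F}_2$ of two elements; $C_2$ is the cyclic group of order $2$. A profinite group $G$ is finitely presented (as a profinite group) if there is an exact sequence $1\to R\to \hat F\to G\to 1$ of profinite groups, where $\hat F$ is the profinite completion of a free group $F$ of finite rank and $R$ is the closed normal subgroup of $\hat F$ generated by some finite set $\{r_1,\dots,r_m\}\subset R$. *)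

(* Defs.v *)
From HB Require Import structures.
From mathcomp Require Import all_boot all_order all_algebra.
From mathcomp Require Import all_classical topology.

Set Implicit Arguments.
Unset Strict Implicit.
Unset Printing Implicit Defensive.

Import GRing.Theory.

Local Open Scope classical_set_scope.
Local Open Scope quotient_scope.
Local Open Scope group_scope.

Section Subgroups.
Variable G : groupType.
Implicit Types (A S : set G).

Definition is_subgroup A : Prop :=
  A 1 /\ forall x y, A x -> A y -> A (x / y).

Definition is_normal_subgroup A : Prop :=
  is_subgroup A /\ forall x g, A x -> A (x ^ g).

Definition generated_subgroup S : set G :=
  \bigcap_(A in [set A | is_subgroup A /\ S `<=` A]) A.

Lemma generated_is_subgroup S : is_subgroup (generated_subgroup S).
Proof.
split=> [A [[]]//|x y Gx Gy A AS].
by case: (AS) => -[_ AF] _; apply: AF; [exact: Gx|exact: Gy].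
Qed.

Lemma is_subgroup_closed A : is_subgroup A -> group_closed (mem A).
Proof.
case=> A1 AF; split; first exact/mem_set.
by move=> x y /set_mem Ax /set_mem Ay; exact/mem_set/AF.
Qed.

End Subgroups.

Record normal_subgroup (G : groupType) := NormalSubgroup {
  nsub_mem :> G -> Prop;
  nsubP : is_normal_subgroup nsub_mem }.

Section QuotientGroup.
Variables (G : groupType) (N : normal_subgroup G).

Let N1 : N 1. Proof. by case: (nsubP N) => -[]. Qed.
Let NF x y : N x -> N y -> N (x / y).
Proof. by case: (nsubP N) => -[_ +] _; apply. Qed.
Let NJ x g : N x -> N (x ^ g).
Proof. by case: (nsubP N) => _; apply. Qed.
Let NV x : N x -> N x^-1. Proof. by move=> /(NF N1); rewrite div1g. Qed.
Let NM x y : N x -> N y -> N (x * y).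
Proof. by move=> Nx /NV Ny; rewrite -[y]invgK; exact: NF. Qed.

(* Quotient of [G] by the relation [xN = yN]. *)
Definition coset_eq (x y : G) : bool := `[< N (x^-1 * y) >].

Lemma coset_eq_equiv : equiv_class_of coset_eq.
Proof.
split=> [x|x y|y x z]; rewrite /coset_eq.
- by rewrite mulVg; exact/asboolP.
- by apply/asboolP/asboolP => /NV; rewrite invgM invgK.
- move=> /asboolP xy /asboolP yz; apply/asboolP.
  by have := NM xy yz; rewrite mulgA mulgK.
Qed.

Canonical coset_eq_equiv_rel := EquivRelPack coset_eq_equiv.
Canonical coset_eq_encModRel := defaultEncModRel coset_eq.

Definition quotient_group := {eq_quot coset_eq}.
HB.instance Definition _ : EqQuotient G coset_eq quotient_group :=
  EqQuotient.on quotient_group.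
HB.instance Definition _ := Choice.on quotient_group.

Lemma quotient_groupP x y :
  \pi_quotient_group x = \pi_quotient_group y <-> N (x^-1 * y).
Proof.
by split=> [/eqP|h]; [|apply/eqP]; rewrite piE; [move/asboolP|apply/asboolP].
Qed.

Definition qone : quotient_group := \pi_quotient_group 1.
Definition qmul (u v : quotient_group) : quotient_group :=
  \pi_quotient_group (repr u * repr v).
Definition qinv (u : quotient_group) : quotient_group := \pi_quotient_group (repr u)^-1.

Lemma pi_qmul x y : qmul (\pi x) (\pi y) = \pi_quotient_group (x * y).
Proof.
apply/quotient_groupP.
have /quotient_groupP := reprK (\pi_quotient_group x).
have /quotient_groupP := reprK (\pi_quotient_group y).
set x' := repr (\pi_quotient_group x); set y' := repr (\pi_quotient_group y).
move=> ny nx.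
have -> : (x' * y')^-1 * (x * y) = (x'^-1 * x) ^ y' * (y'^-1 * y).
  by rewrite invgM /conjg !mulgA mulgK.
exact: NM (NJ _ nx) ny.
Qed.

Lemma pi_qinv x : qinv (\pi x) = \pi_quotient_group x^-1.
Proof.
apply/quotient_groupP.
have /quotient_groupP /NV := reprK (\pi_quotient_group x).
set x' := repr (\pi_quotient_group x) => nx.
have -> : x'^-1^-1 * x^-1 = ((x'^-1 * x)^-1) ^ x'^-1.
  by rewrite invgM /conjg !invgK !mulgA mulgK.
exact: NJ.
Qed.

Lemma qmulA : associative qmul.
Proof.
by move=> u v w; rewrite -[u]reprK -[v]reprK -[w]reprK !pi_qmul mulgA.
Qed.
Lemma qmul1 : left_id qone qmul.
Proof. by move=> u; rewrite -[u]reprK pi_qmul mul1g. Qed.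
Lemma qmulr1 : right_id qone qmul.
Proof. by move=> u; rewrite -[u]reprK pi_qmul mulg1. Qed.
Lemma qmulV : left_inverse qone qinv qmul.
Proof. by move=> u; rewrite -[u]reprK pi_qinv pi_qmul mulVg. Qed.
Lemma qmulrV : right_inverse qone qinv qmul.
Proof. by move=> u; rewrite -[u]reprK pi_qinv pi_qmul mulgV. Qed.

HB.instance Definition _ :=
  isGroup.Build quotient_group qmulA qmul1 qmulr1 qmulV qmulrV.

Definition qproj (x : G) : quotient_group := \pi x.

Lemma qproj_eq x y : qproj x = qproj y <-> N (x^-1 * y).
Proof. exact: quotient_groupP. Qed.
Lemma qproj1 : qproj 1 = 1. Proof. by []. Qed.
Lemma qprojM x y : qproj (x * y) = qproj x * qproj y.
Proof. by symmetry; exact: pi_qmul. Qed.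
Lemma qprojV x : qproj x^-1 = (qproj x)^-1.
Proof. by symmetry; exact: pi_qinv. Qed.
Lemma qproj_surj u : exists x, u = qproj x.
Proof. by exists (repr u); rewrite /qproj reprK. Qed.

End QuotientGroup.
Arguments qproj {G} N x.

HB.mixin Record isTopologicalGroup G of Group G & Topological G := {
  mulg_continuous : continuous (fun p : G * G => p.1 * p.2);
  invg_continuous : continuous (fun x : G => x^-1) }.

#[short(type="topologicalGroup")]
HB.structure Definition TopologicalGroup :=
  { G of Group G & Topological G & isTopologicalGroup G }.

HB.mixin Record isProfinite G of TopologicalGroup G := {
  profinite_compact : compact [set: G];
  profinite_hausdorff : hausdorff_space G;
  profinite_totally_disconnected : totally_disconnected [set: G] }.

#[short(type="profiniteGroup")]
HB.structure Definition ProfiniteGroup :=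
  { G of TopologicalGroup G & isProfinite G }.

Record finite_index_normal (G : groupType) := FiniteIndexNormal {
  fin_nsub :> normal_subgroup G;
  finite_indexP : finite_set [set: quotient_group fin_nsub] }.

Section ProfiniteCompletion.
Variable G : groupType.
Implicit Types N M : finite_index_normal G.

Definition finite_quotient N : Type := quotient_group N.
HB.instance Definition _ N := Group.on (finite_quotient N).
HB.instance Definition _ N :=
  DiscreteTopology.copy (finite_quotient N) (discrete_topology (quotient_group N)).

(* The inverse limit of the finite quotients [G / N]: the families that are
   compatible with the projections [gN |-> gM] for [N] contained in [M]. *)
Definition compatible_family : set (prod_topology (fun N => finite_quotient N : topologicalType)) :=
  [set x | forall N M, (forall g, N g -> M g) ->
     forall g, x N = qproj N g -> x M = qproj M g].

Definition profinite_completion : Type := set_type compatible_family.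
HB.instance Definition _ :=
  Topological.copy profinite_completion (set_type compatible_family).
HB.instance Definition _ := SubChoice.on profinite_completion.

Definition pc_coord N (x : profinite_completion) : finite_quotient N := val x N.

Lemma pc_eqP (x y : profinite_completion) :
  (forall N, pc_coord N x = pc_coord N y) -> x = y.
Proof. by move=> xy; apply/val_inj/functional_extensionality_dep. Qed.

Lemma pc_compat (x : profinite_completion) N M : (forall g, N g -> M g) ->
  forall g, pc_coord N x = qproj N g ->
    pc_coord M x = qproj M g.
Proof. by move=> NM g; apply: (set_mem (valP x)). Qed.

Lemma pc_compatL N M (x y : G) : (forall g, N g -> M g) ->
  qproj N x = qproj N y -> qproj M x = qproj M y.
Proof. by move=> NM /qproj_eq /NM Mxy; apply/qproj_eq. Qed.

Lemma pc_one_subproof : compatible_family (fun N => 1).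
Proof. by move=> N M NM g; rewrite -!qproj1; exact: pc_compatL. Qed.

Lemma pc_mul_subproof (x y : profinite_completion) :
  compatible_family (fun N => pc_coord N x * pc_coord N y).
Proof.
move=> N M NM g.
have [a xN] := qproj_surj (pc_coord N x); have [b yN] := qproj_surj (pc_coord N y).
rewrite (pc_compat NM xN) (pc_compat NM yN) xN yN -!qprojM; exact: pc_compatL.
Qed.

Lemma pc_inv_subproof (x : profinite_completion) :
  compatible_family (fun N => (pc_coord N x)^-1).
Proof.
move=> N M NM g; have [a xN] := qproj_surj (pc_coord N x).
rewrite (pc_compat NM xN) xN -!qprojV; exact: pc_compatL.
Qed.

Definition pc_one : profinite_completion := exist [in compatible_family] _ (mem_set pc_one_subproof).
Definition pc_mul (x y : profinite_completion) : profinite_completion :=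
  exist [in compatible_family] _ (mem_set (@pc_mul_subproof x y)).
Definition pc_inv (x : profinite_completion) : profinite_completion :=
  exist [in compatible_family] _ (mem_set (@pc_inv_subproof x)).

Lemma pc_mulA : associative pc_mul.
Proof. by move=> x y z; apply: pc_eqP => N; exact: mulgA. Qed.
Lemma pc_mul1 : left_id pc_one pc_mul.
Proof. by move=> x; apply: pc_eqP => N; exact: mul1g. Qed.
Lemma pc_mulr1 : right_id pc_one pc_mul.
Proof. by move=> x; apply: pc_eqP => N; exact: mulg1. Qed.
Lemma pc_mulV : left_inverse pc_one pc_inv pc_mul.
Proof. by move=> x; apply: pc_eqP => N; exact: mulVg. Qed.
Lemma pc_mulrV : right_inverse pc_one pc_inv pc_mul.
Proof. by move=> x; apply: pc_eqP => N; exact: mulgV. Qed.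

HB.instance Definition _ := isGroup.Build profinite_completion
  pc_mulA pc_mul1 pc_mulr1 pc_mulV pc_mulrV.

Lemma pc_coord_continuous N : continuous (@pc_coord N).
Proof.
move=> x; apply: (@continuous_comp _ _ _ (val : profinite_completion -> _)
  (fun f => f N)).
  exact: initial_continuous.
exact: (@proj_continuous {classic finite_index_normal G} (fun N => finite_quotient N : topologicalType) N).
Qed.

Lemma pc_coord_nbhs N (x : profinite_completion) :
  nbhs x [set y | pc_coord N y = pc_coord N x].
Proof. exact: pc_coord_continuous (discrete_set1 (pc_coord N x)). Qed.

Lemma pc_continuous (T : topologicalType) (f : T -> profinite_completion) :
  (forall N, continuous (@pc_coord N \o f)) -> continuous f.
Proof.
move=> cf; apply: (@continuous_comp_initial profinite_completion T _ val).
move=> t; apply/cvg_sup => N; move: t.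
exact: (@continuous_comp_initial _ _ _ (fun f => f N) _ (cf N)).
Qed.

Lemma pc_mul_continuous :
  continuous (fun p : profinite_completion * profinite_completion => p.1 * p.2).
Proof.
apply: pc_continuous => N p; apply/discrete_cvg.
exists ([set y | pc_coord N y = pc_coord N p.1],
        [set y | pc_coord N y = pc_coord N p.2]).
  by split; exact: pc_coord_nbhs.
move=> [q1 q2] /= [q1p q2p].
by rewrite -[LHS]/(pc_coord N q1 * pc_coord N q2) q1p q2p.
Qed.

Lemma pc_inv_continuous : continuous (fun x : profinite_completion => x^-1).
Proof.
apply: pc_continuous => N p; apply/discrete_cvg; first exact: (@fmap_filter _ _ _ _ (nbhs_filter _)).
apply: (@filterS _ (nbhs p) _ _ _ _ (pc_coord_nbhs N p)) => q /= qp.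
by rewrite -[LHS]/((pc_coord N q)^-1) qp.
Qed.

HB.instance Definition _ := isTopologicalGroup.Build profinite_completion
  pc_mul_continuous pc_inv_continuous.

Lemma pc_compact : compact [set: profinite_completion].
Proof.
move=> F FF _.
have cN N : compact [set: finite_quotient N].
  by apply: finite_compact; exact: finite_indexP.
have [f [_ Ff]] := @tychonoff {classic finite_index_normal G}
  (fun N => finite_quotient N : topologicalType) (fun=> setT) cN
  (fmap val F) _ (filterS (fun _ _ _ => I) filterT).
have near_f N : nbhs (f : prod_topology _) (fun h => h N = f N).
  exact: (@proj_continuous {classic finite_index_normal G}
    (fun N => finite_quotient N : topologicalType) N f _ (discrete_set1 _)).
have cf : compatible_family f.
  move=> N M NM g fN.
  have [h [[x _ <-] [xN xM]]] :=
    Ff _ _ (@filterS _ F _ _ _ (fun x _ => imageP val (I : setT x)) filterT)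
      (filterI (near_f N) (near_f M)).
  by rewrite -xM; apply: (@pc_compat x N M) => //; rewrite -fN -xN.
exists (exist [in compatible_family] f (mem_set cf)); split => // A B FA.
move=> [_ [[C oC <-] Cf CB]].
have [_ [[x Ax <-] Cx]] :=
  Ff _ _ (@filterS _ F _ _ _ (fun x Ax => imageP val Ax) FA)
    (open_nbhs_nbhs (conj oC Cf)).
by exists x; split => //; exact: CB.
Qed.

Lemma pc_hausdorff : hausdorff_space profinite_completion.
Proof.
move=> x y xy; apply: pc_eqP => N.
by have [z [/= <- <-]] := xy _ _ (pc_coord_nbhs N x) (pc_coord_nbhs N y).
Qed.

Lemma pc_zero_dimensional : zero_dimensional profinite_completion.
Proof.
move=> x y xy.
have /existsNP [N xyN] : ~ forall N, pc_coord N x = pc_coord N y.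
  by move=> /pc_eqP; exact/eqP.
exists (@pc_coord N @^-1` [set pc_coord N x]); split => //; last exact/nesym.
apply: preimage_clopen => [|z]; last exact: pc_coord_continuous.
by split; [exact: discrete_open|exact: discrete_closed].
Qed.

HB.instance Definition _ := isProfinite.Build profinite_completion
  pc_compact pc_hausdorff
  (zero_dimension_totally_disconnected pc_zero_dimensional).

End ProfiniteCompletion.

Section FreeGroup.
Variable X : choiceType.

(* The letter [(x, false)] stands for the generator [x] and [(x, true)] for its
   inverse. *)
Definition letter : Type := X * bool.
HB.instance Definition _ := Choice.on letter.
Implicit Types (l : letter) (u v w : seq letter).

Definition linv l : letter := (l.1, ~~ l.2).

Fixpoint reduced w : bool :=
  if w is l :: w' then
    (if w' is l' :: _ then l' != linv l else true) && reduced w'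
  else true.

Definition cons_letter l w : seq letter :=
  if w is l' :: w' then if l' == linv l then w' else l :: w else [:: l].

Definition reduced_cat u w : seq letter := foldr cons_letter w u.

Lemma linvK : involutive linv.
Proof. by case=> x b; rewrite /linv /= negbK. Qed.

Lemma cons_letter_reduced l w : reduced w -> reduced (cons_letter l w).
Proof.
case: w => [//|l' w] rw /=; case: eqVneq => [_|neq]; last by rewrite /= neq.
by case/andP: rw.
Qed.

Lemma reduced_cat_reduced u w : reduced w -> reduced (reduced_cat u w).
Proof. by move=> rw; elim: u => //= l u; exact: cons_letter_reduced. Qed.

Lemma cons_letterK l w : reduced w -> cons_letter (linv l) (cons_letter l w) = w.
Proof.
case: w => [_|l' w /= /andP[rl rw]] /=; first by rewrite linvK eqxx.
case: eqVneq => [l'E|neq] /=; last by rewrite linvK eqxx.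
rewrite -l'E; case: w rl {rw} => //= l'' w; by case: eqP.
Qed.

Lemma reduced_cat_cons l u w : reduced u -> reduced w ->
  reduced_cat (cons_letter l u) w = cons_letter l (reduced_cat u w).
Proof.
case: u => //= l' u /andP[_ ru] rw; case: eqVneq => //= ->.
have := @cons_letterK (linv l) (reduced_cat u w); rewrite linvK => -> //.
exact: reduced_cat_reduced.
Qed.

Lemma reduced_catA u v w : reduced v -> reduced w ->
  reduced_cat u (reduced_cat v w) = reduced_cat (reduced_cat u v) w.
Proof.
move=> rv rw; elim: u => //= l u IH.
by rewrite reduced_cat_cons ?IH //; exact: reduced_cat_reduced.
Qed.

Lemma reduced_cats0 u : reduced u -> reduced_cat u [::] = u.
Proof.
elim: u => //= l u IH /andP[lu ru]; rewrite IH //.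
by case: u lu {ru IH} => //= l' u /negPf ->.
Qed.

Lemma reduced_cat_cat u v w :
  reduced_cat (u ++ v) w = reduced_cat u (reduced_cat v w).
Proof. exact: foldr_cat. Qed.

Definition word_inv u : seq letter := reduced_cat (rev (map linv u)) [::].

Lemma word_inv_reduced u : reduced (word_inv u).
Proof. exact: reduced_cat_reduced. Qed.

Lemma word_invV u : reduced u -> reduced_cat (word_inv u) u = [::].
Proof.
move=> ru; rewrite /word_inv -reduced_catA //.
elim: u ru => //= l u IH /andP[_ ru].
by rewrite rev_cons -cats1 reduced_cat_cat /= linvK eqxx IH.
Qed.

Lemma word_invrV u : reduced_cat u (word_inv u) = [::].
Proof.
rewrite /word_inv; have : reduced [::] by [].
elim: u (Nil letter) => //= l u IH w rw.
rewrite rev_cons -cats1 reduced_cat_cat /=.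
have rlw : reduced (cons_letter (linv l) w) by exact: cons_letter_reduced.
by rewrite IH //; have := @cons_letterK (linv l) w; rewrite linvK; exact.
Qed.

Record free_group : Type := FreeGroup {
  free_word : seq letter;
  free_wordP : reduced free_word }.

HB.instance Definition _ := [isSub for free_word].
HB.instance Definition _ := [Choice of free_group by <:].

Definition free_one : free_group := @FreeGroup [::] isT.
Definition free_mul (x y : free_group) : free_group :=
  FreeGroup (reduced_cat_reduced (free_word x) (free_wordP y)).
Definition free_inv (x : free_group) : free_group :=
  FreeGroup (word_inv_reduced (free_word x)).

Lemma free_mulA : associative free_mul.
Proof. by move=> x y z; apply/val_inj/reduced_catA; exact: free_wordP. Qed.
Lemma free_mul1 : left_id free_one free_mul.
Proof. by move=> x; exact: val_inj. Qed.
Lemma free_mulr1 : right_id free_one free_mul.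
Proof. by move=> x; apply/val_inj/reduced_cats0/free_wordP. Qed.
Lemma free_mulV : left_inverse free_one free_inv free_mul.
Proof. by move=> x; apply/val_inj/word_invV/free_wordP. Qed.
Lemma free_mulrV : right_inverse free_one free_inv free_mul.
Proof. by move=> x; apply/val_inj/word_invrV. Qed.

HB.instance Definition _ := isGroup.Build free_group
  free_mulA free_mul1 free_mulr1 free_mulV free_mulrV.

End FreeGroup.

Definition closed_normal_closure (G : topologicalGroup) (S : set G) : set G :=
  \bigcap_(A in [set A | [/\ is_normal_subgroup A, closed A & S `<=` A]]) A.

Definition finitely_presented_profinite (G : profiniteGroup) : Prop :=
  exists (n : nat)
    (q : {multiplicative profinite_completion (free_group 'I_n) -> G})
    (r : seq (profinite_completion (free_group 'I_n))),
    [/\ continuous q, range q = [set: G] &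
        q @^-1` [set 1] = closed_normal_closure [set` r]].

Section TreeAutomorphisms.
Variable X : choiceType.

Definition child (v w : seq X) : Prop := exists x, w = rcons v x.

Definition is_tree_automorphism : set (seq X -> seq X) :=
  [set f | [/\ bijective f, f [::] = [::] &
    forall v w, child v w <-> child (f v) (f w)]].

Definition tree_automorphism : Type := set_type is_tree_automorphism.
HB.instance Definition _ := SubChoice.on tree_automorphism.

Implicit Types f g h : tree_automorphism.

Definition tree_fun f : seq X -> seq X := val f.
Coercion tree_fun : tree_automorphism >-> Funclass.

Definition mk_tree_automorphism (f : seq X -> seq X)
    (fP : is_tree_automorphism f) : tree_automorphism :=
  exist [in is_tree_automorphism] f (mem_set fP).

Lemma tree_automorphismP f g : (forall w, f w = g w) -> f = g.
Proof. by move=> fg; apply/val_inj/funext. Qed.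

Lemma ta_one_subproof : is_tree_automorphism id.
Proof. by split => //; exists id. Qed.

Lemma ta_mul_subproof f g : is_tree_automorphism (f \o g).
Proof.
have [bf f0 fc] := set_mem (valP f); have [bg g0 gc] := set_mem (valP g).
split; first exact: bij_comp.
  by rewrite -[RHS]f0 -[in RHS]g0.
by move=> v w; apply: (iff_trans (gc v w)); exact: fc.
Qed.

Lemma ta_inv_ex f : exists g : tree_automorphism, cancel f g /\ cancel g f.
Proof.
have [[g fK gK] f0 fc] := set_mem (valP f).
suff gP : is_tree_automorphism g by exists (mk_tree_automorphism gP).
split; first by exists (val f).
  by rewrite -[in LHS]f0 fK.
by move=> v w; have := fc (g v) (g w); rewrite !gK => -[? ?]; split.
Qed.

Definition ta_one := mk_tree_automorphism ta_one_subproof.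
Definition ta_mul f g := mk_tree_automorphism (ta_mul_subproof f g).
Definition ta_inv f := projT1 (cid (ta_inv_ex f)).

Lemma ta_mulA : associative ta_mul. Proof. by move=> f g h; apply: val_inj. Qed.
Lemma ta_mul1 : left_id ta_one ta_mul. Proof. by move=> f; apply: val_inj. Qed.
Lemma ta_mulr1 : right_id ta_one ta_mul. Proof. by move=> f; apply: val_inj. Qed.
Lemma ta_mulV : left_inverse ta_one ta_inv ta_mul.
Proof.
move=> f; apply: tree_automorphismP => w.
by have [fK _] := projT2 (cid (ta_inv_ex f)); exact: fK.
Qed.
Lemma ta_mulrV : right_inverse ta_one ta_inv ta_mul.
Proof.
move=> f; apply: tree_automorphismP => w.
by have [_ fK] := projT2 (cid (ta_inv_ex f)); exact: fK.
Qed.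

HB.instance Definition _ := isGroup.Build tree_automorphism
  ta_mulA ta_mul1 ta_mulr1 ta_mulV ta_mulrV.

End TreeAutomorphisms.

(* The letters 0 and 1 are [false] and [true]. *)
Definition grig_a_fun (w : seq bool) : seq bool :=
  if w is x :: w' then ~~ x :: w' else [::].

Fixpoint grig_b_fun (w : seq bool) : seq bool :=
  match w with
  | [::] => [::]
  | false :: w' => false :: grig_a_fun w'
  | true :: w' => true :: grig_c_fun w'
  end
with grig_c_fun (w : seq bool) : seq bool :=
  match w with
  | [::] => [::]
  | false :: w' => false :: grig_a_fun w'
  | true :: w' => true :: grig_d_fun w'
  end
with grig_d_fun (w : seq bool) : seq bool :=
  match w with
  | [::] => [::]
  | false :: w' => false :: w'
  | true :: w' => true :: grig_b_fun w'
  end.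

Lemma involutive_tree_automorphism (X : choiceType) (f : seq X -> seq X) :
  involutive f -> f [::] = [::] ->
  (forall v x, child (f v) (f (rcons v x))) -> is_tree_automorphism f.
Proof.
move=> fK f0 fc; split => //; first by exists f.
move=> v w; split=> [[x ->]|[x fwE]]; first exact: fc.
by rewrite -[v]fK -[w]fK fwE; exact: fc.
Qed.

Lemma grig_a_funP : is_tree_automorphism grig_a_fun.
Proof.
apply: involutive_tree_automorphism => //.
  by case=> //= x w; rewrite negbK.
by case=> [|y v] x; [exists (~~ x)|exists x].
Qed.

Lemma grig_bcd_funK (w : seq bool) :
  [/\ grig_b_fun (grig_b_fun w) = w, grig_c_fun (grig_c_fun w) = w &
      grig_d_fun (grig_d_fun w) = w].
Proof.
have aK : involutive grig_a_fun by case=> //= x w'; rewrite negbK.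
by elim: w => //= -[] w [bK cK dK] /=; rewrite ?aK ?bK ?cK ?dK.
Qed.

Lemma grig_bcd_fun_child (v : seq bool) x :
  [/\ child (grig_b_fun v) (grig_b_fun (rcons v x)),
      child (grig_c_fun v) (grig_c_fun (rcons v x)) &
      child (grig_d_fun v) (grig_d_fun (rcons v x))].
Proof.
have [_ _ ac] := grig_a_funP.
elim: v => [|y v [[b bE] [c cE] [d dE]]].
  by case: x; split; solve [by exists true | by exists false].
have [a aE] : child (grig_a_fun v) (grig_a_fun (rcons v x)) 
  by apply: (proj1 (ac v (rcons v x))); exists x.
case: y => /=; rewrite ?aE ?bE ?cE ?dE.
  by split; [exists c|exists d|exists b].
by split; [exists a|exists a|exists x].
Qed.

Lemma grig_b_funP : is_tree_automorphism grig_b_fun.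
Proof.
apply: involutive_tree_automorphism => // [w|v x].
  by case: (grig_bcd_funK w).
by case: (grig_bcd_fun_child v x).
Qed.

Lemma grig_c_funP : is_tree_automorphism grig_c_fun.
Proof.
apply: involutive_tree_automorphism => // [w|v x].
  by case: (grig_bcd_funK w).
by case: (grig_bcd_fun_child v x).
Qed.

Lemma grig_d_funP : is_tree_automorphism grig_d_fun.
Proof.
apply: involutive_tree_automorphism => // [w|v x].
  by case: (grig_bcd_funK w).
by case: (grig_bcd_fun_child v x).
Qed.

Definition grig_a := mk_tree_automorphism grig_a_funP.
Definition grig_b := mk_tree_automorphism grig_b_funP.
Definition grig_c := mk_tree_automorphism grig_c_funP.
Definition grig_d := mk_tree_automorphism grig_d_funP.

Definition grigorchuk_set : set (tree_automorphism bool) :=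
  generated_subgroup [set grig_a; grig_b; grig_c; grig_d].

Definition grigorchuk : Type := set_type grigorchuk_set.
HB.instance Definition _ := SubChoice.on grigorchuk.
HB.instance Definition _ :=
  SubChoice_isSubGroup.Build (tree_automorphism bool) [in grigorchuk_set] grigorchuk
    (is_subgroup_closed (generated_is_subgroup _)).

Section Cohomology.
Local Open Scope ring_scope.
Variables (G : topologicalGroup) (A : zmodType).

(* Inhomogeneous cochains, with [G] acting trivially on [A]. *)
Definition cochain (n : nat) : Type := ('I_n -> G) -> A.
HB.instance Definition _ n := GRing.Zmodule.on (cochain n).

Definition continuous_cochain n (f : cochain n) : Prop :=
  continuous (f : prod_topology (fun _ : 'I_n => G : topologicalType) ->
                  discrete_topology A).

(* [contract j (g_0, ..., g_n) = (g_0, ..., g_j g_(j+1), ..., g_n)] *)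
Definition contract n (j : 'I_n) (g : 'I_n.+1 -> G) : 'I_n -> G := fun i =>
  if (i < j)%N then g (widen_ord (leqnSn n) i)
  else if i == j then (g (widen_ord (leqnSn n) i) * g (lift ord0 i))%g
  else g (lift ord0 i).

Definition coboundary n (f : cochain n) : cochain n.+1 := fun g =>
  f (fun i => g (lift ord0 i))
  + \sum_(j < n) f (contract j g) *~ (-1) ^+ j.+1
  + f (fun i => g (widen_ord (leqnSn n) i)) *~ (-1) ^+ n.+1.

Lemma coboundaryB n (f g : cochain n) :
  coboundary (f - g) = coboundary f - coboundary g.
Proof.
apply/funext => x; rewrite /coboundary.
rewrite (_ : (\sum_(j < n) _) =
    \sum_(j < n) f (contract j x) *~ (-1) ^+ j.+1 -
    \sum_(j < n) g (contract j x) *~ (-1) ^+ j.+1); last first.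
  by rewrite -sumrB; apply: eq_bigr => j _; rewrite -mulrzBl.
have sumB (a b c d e h : A) : (a - b) + (c - d) + (e - h) = (a + c + e) - (b + d + h).
  by rewrite (addrACA a) (addrACA (a + c)) -!opprD.
by rewrite [X in _ + X]mulrzBl; exact: sumB.
Qed.

Lemma continuous_cochainP n (f : cochain n) : continuous_cochain f <->
  forall x, nbhs (x : prod_topology (fun _ : 'I_n => G : topologicalType))
    [set y | f y = f x].
Proof.
split=> [cf x|cf x].
  exact: (cf x _ (discrete_set1 (f x : discrete_topology A))).
by apply/discrete_cvg; [exact: (@fmap_filter _ _ _ _ (nbhs_filter _))|exact: cf].
Qed.

Lemma continuous_cochainB n (f g : cochain n) :
  continuous_cochain f -> continuous_cochain g -> continuous_cochain (f - g).
Proof.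
move=> /continuous_cochainP cf /continuous_cochainP cg.
apply/continuous_cochainP => x; have Fx : Filter (nbhs x) := nbhs_filter x.
apply: (@filterS _ (nbhs x) _ _ _ _ (filterI (cf x) (cg x))) => y [/= fy gy].
by rewrite -[LHS]/(f y - g y) fy gy.
Qed.

Lemma continuous_cochain0 n : continuous_cochain (0 : cochain n).
Proof.
apply/continuous_cochainP => x; have Fx : Filter (nbhs x) := nbhs_filter x.
by apply: (@filterS _ (nbhs x) _ _ _ _ filterT) => y _.
Qed.

Lemma coboundary0 n : coboundary (0 : cochain n) = 0.
Proof. by rewrite -(subrr (0 : cochain n)) coboundaryB subrr. Qed.

Definition cocycle_set n : set (cochain n) :=
  [set f | continuous_cochain f /\ coboundary f = 0].

Lemma cocycle_zmod_closed n : zmod_closed [in @cocycle_set n].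
Proof.
split=> [|f g /set_mem [cf df] /set_mem [cg dg]]; apply/mem_set.
  by split; [exact: continuous_cochain0|exact: coboundary0].
split; first exact: continuous_cochainB.
by rewrite coboundaryB df dg subrr.
Qed.

Definition cocycle n : Type := set_type (@cocycle_set n).
HB.instance Definition _ n := SubChoice.on (cocycle n).
HB.instance Definition _ n := GRing.SubChoice_isSubZmodule.Build
  (cochain n) [in @cocycle_set n] (cocycle n) (@cocycle_zmod_closed n).

(* There are no cochains in negative degree. *)
Definition is_coboundary n : set (cochain n) :=
  if n is m.+1 then
    [set f | exists2 h : cochain m, continuous_cochain h & f = coboundary h]
  else [set 0].

Definition coboundaries n : {pred cocycle n} :=
  [pred z | `[< is_coboundary (val z) >]].

Lemma coboundaries_zmod_closed n : zmod_closed (@coboundaries n).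
Proof.
split=> [|f g /asboolP bf /asboolP bg]; apply/asboolP.
  rewrite raddf0; case: n => //= m.
  by exists 0; [exact: continuous_cochain0|rewrite coboundary0].
rewrite raddfB; case: n f g bf bg => [|m] f g /=.
  by move=> -> ->; rewrite subrr.
move=> [h ch ->] [k ck ->]; exists (h - k); first exact: continuous_cochainB.
by rewrite coboundaryB.
Qed.

HB.instance Definition _ n := GRing.isZmodClosed.Build (cocycle n)
  (@coboundaries n) (@coboundaries_zmod_closed n).

Definition cohomology n : zmodType := Quotient.quot (@coboundaries n).

End Cohomology.

Section DirectSum.
Local Open Scope ring_scope.
Variables (I : Type) (A : zmodType).

Definition finite_support : set (I -> A) := [set f | finite_set [set i | f i != 0]].

Lemma finite_support_zmod_closed : zmod_closed [in finite_support].
Proof.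
split=> [|f g /set_mem ff /set_mem fg]; apply/mem_set.
  rewrite /finite_support /= (_ : [set i | _] = set0) //.
  by rewrite -subset0 => i /=; rewrite eqxx.
apply: (@sub_finite_set _ _ ([set i | f i != 0] `|` [set i | g i != 0])).
  move=> i /=; case: (eqVneq (f i) 0) => [fi|]; last by left.
  case: (eqVneq (g i) 0) => [gi|]; last by right.
  by rewrite -[(f - g) i]/(f i - g i) fi gi subrr eqxx.
by rewrite finite_setU.
Qed.

Definition direct_sum : Type := set_type finite_support.
HB.instance Definition _ := SubChoice.on direct_sum.
HB.instance Definition _ := GRing.SubChoice_isSubZmodule.Build
  (I -> A) [in finite_support] direct_sum finite_support_zmod_closed.

End DirectSum.

Definition zmod_isomorphic (U V : zmodType) : Prop :=
  exists f : {additive U -> V}, bijective f.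

(* Main.v *)
(* Writing g|x for the section of g in G at the letter x, the dihedral group of
order 16 is a quotient of G (a -> s, b, c -> t, d -> 1), and its extension to the
dihedral group of order 32 pulls back to a 2-cocycle f_0 on G.  If f is a 2-cocycle
then so is (Tf)(g, h) = f(g|h(0), h|0) + f(g|h(1), h|1), the transfer of its pull-back
from the stabiliser of the first level, and f_n = T^n f_0 still factors through a
finite quotient of G.

Let sigma be Lysenok's substitution a -> aca, b -> d, c -> b, d -> c and
y_m = sigma^m(ac), so that y_m^8 = 1 in G.  The sections of sigma(w) are w and an
element of exponent 4, whence the restrictions to cyclic groups of order 8 satisfy
f_n|<y_{n+m}> = f_0|<y_m>, which is nonzero exactly for m = 0.  So the classes of
the f_n are pairwise distinct and H^2 is infinite; it is countable because G, being
finitely generated, has countably many finite quotients.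

If the completion of G had a presentation q : F^ -> G^ with finitely many relators,
each q^* f_n would be the coboundary of some continuous h_n.  Two of the h_n would
agree on all the relators; their difference restricts to an invariant homomorphism on
ker q, so it would vanish there and descend to G, splitting f_m + f_n. *)
Require Import Defs.
From HB Require Import structures.
From mathcomp Require Import all_boot all_order all_algebra.
From mathcomp Require Import all_classical topology.

Set Implicit Arguments.
Unset Strict Implicit.
Unset Printing Implicit Defensive.

Import GRing.Theory.

Local Open Scope classical_set_scope.
Local Open Scope group_scope.

(** * Countable groups of exponent 2 *)

Section ElementaryAbelian.
Local Open Scope ring_scope.
Variable U : zmodType.
Hypothesis U2 : forall u : U, u + u = 0.

Lemma mulr_Z2D (u : U) (c c' : 'Z_2) : u *+ (c + c')%R = u *+ c + u *+ c'.
Proof.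
have -> : nat_of_ord (c + c')%R = ((c + c') %% 2)%N by [].
by case: c c' => [[|[|//]] ?] [[|[|//]] ?]; rewrite [nat_of_ord _]/= ?mulr0n ?add0r ?addr0 // U2.
Qed.

(** When [U] has exponent 2 this lists the F_2-span of [s]; a list makes finiteness of the span and
    decidability of membership immediate. *)
Fixpoint span2 (s : seq U) : seq U :=
  if s is u :: s' then span2 s' ++ [seq u + v | v <- span2 s'] else [:: 0].

(** A basis is extracted greedily from the enumeration, and coordinates in it give the
    isomorphism. *)
Lemma countable_elementary_abelian (e : nat -> U) :
  (forall u, exists n, e n = u) -> infinite_set [set: U] ->
  zmod_isomorphic U (direct_sum nat 'Z_2).
Proof.
move=> e_surj U_inf.
have ex_out s : exists n, e n \notin span2 s.
  apply: contrapT => /forallNP e_in; apply: U_inf.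
  apply: (@sub_finite_set _ _ [set` span2 s]) => // u _.
  by have [n <-] := e_surj u; have /negP := e_in n; rewrite negbK.
(* [next s] is the first enumerated element outside the span of [s]; the basis [b] iterates this
   choice. *)
pose next s := e (ex_minn (ex_out s)).
pose bs k := iter k (fun s => next s :: s) [::].
pose b k := next (bs k).
have b_out k : b k \notin span2 (bs k) by rewrite /b /next; case: ex_minnP.
have spanP k u : u \in span2 (bs k) <-> exists c : nat -> 'Z_2, u = \sum_(i < k) b i *+ c i.
  elim: k u => [|k IH] u.
    rewrite /= inE; split=> [/eqP ->|[c ->]]; last by rewrite big_ord0.
    by exists (fun=> 0); rewrite big_ord0.
  rewrite /= mem_cat; split.
    move=> /orP[/IH[c ->]|/mapP[v /IH[c ->] ->]].
      exists (fun i => if i == k then 0 else c i).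
      rewrite big_ord_recr /= eqxx mulr0n addr0; apply: eq_bigr => i _.
      by rewrite ltn_eqF.
    exists (fun i => if i == k then 1 else c i).
    rewrite big_ord_recr /= eqxx mulr1n addrC; congr (_ + _); apply: eq_bigr => i _.
    by rewrite ltn_eqF.
  move=> [c ->]; rewrite big_ord_recr /=; apply/orP.
  have IHc : \sum_(i < k) b i *+ c i \in span2 (bs k) by apply/IH; exists c.
  case: (c k) => -[|[|//]] ck /=; first by left; rewrite mulr0n addr0.
  by right; apply/mapP; exists (\sum_(i < k) b i *+ c i); rewrite // mulr1n addrC.
have span_mono k l u : (k <= l)%N -> u \in span2 (bs k) -> u \in span2 (bs l).
  move=> kl uk; rewrite -(subnK kl); elim: (l - k)%N => //= m IH.
  by rewrite mem_cat IH.
have e_span k n : (n < k)%N -> e n \in span2 (bs k).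
  elim: k n => // k IH n; rewrite ltnS leq_eqVlt => /predU1P[->|nk]; last first.
    by rewrite (span_mono k) // IH.
  rewrite /= mem_cat; case: (boolP (e k \in span2 (bs k))) => //= ek.
  (* All earlier [e n] lie in the span, so the first element outside it is [e k] itself. *)
  have -> : e k = b k.
    rewrite /b /next; case: ex_minnP => m m_out m_min; congr e.
    apply/eqP; rewrite eqn_leq (m_min _ ek) andbT leqNgt; apply/negP => mk.
    by rewrite IH in m_out.
  apply/mapP; exists 0; last by rewrite addr0.
  by apply/spanP; exists (fun=> 0); rewrite big1.
pose V := direct_sum nat 'Z_2.
have /choice [B BP] : forall f : V, exists B, forall i, (B <= i)%N -> val f i = 0.
  move=> f; have /finite_seqP[X fX] := set_mem (valP f).
  exists (\max_(i <- X) i).+1 => i Xi; apply/eqP; apply: contraTT Xi => fi.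
  rewrite -ltnNge ltnS; apply: (@leq_bigmax_seq _ _ xpredT id) => //.
  by have : [set` X] i; [rewrite -fX|].
pose phi (f : V) : U := \sum_(i < B f) b i *+ (val f i : 'Z_2).
have phiE n f : (B f <= n)%N -> phi f = \sum_(i < n) b i *+ (val f i : 'Z_2).
  move=> Bn; rewrite /phi (big_ord_widen _ (fun i => b i *+ (val f i : 'Z_2)) Bn) big_mkcond.
  by apply: eq_bigr => i _; case: ltnP => // Bi; rewrite BP.
have phiD f g : phi (f + g) = phi f + phi g.
  set n := maxn (B (f + g)) (maxn (B f) (B g)).
  rewrite !(phiE n) ?leq_max ?leqnn ?orbT // -big_split; apply: eq_bigr => i _.
  exact: mulr_Z2D.
have phi0 f : phi f = 0 -> f = 0.
  move=> phif0; apply/val_inj/funext => i;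
  have : forall n, \sum_(i < n) b i *+ (val f i : 'Z_2) = 0 -> forall i, (i < n)%N -> val f i = 0.
    elim=> // n IH; rewrite big_ord_recr /= => sum0 j; rewrite ltnS leq_eqVlt.
    have fn0 : val f n = 0.
      move: sum0; case fnE: (val f n) => [[|[|//]] lt2] sum0; first exact/val_inj.
      (* A last coefficient equal to 1 would put [b n] in the span of the earlier basis elements. *)
      move: (b_out n); rewrite (_ : b n = \sum_(i < n) b i *+ (val f i : 'Z_2)).
        by move=> /negP[]; apply/spanP; exists (val f).
      apply: (addrI (\sum_(i < n) b i *+ (val f i : 'Z_2))).
        by rewrite U2 -[RHS]sum0 -[sval f n]/(val f n) fnE.
    case/predU1P=> [->//|jn]; apply: IH jn.
    by move: sum0; rewrite fn0 mulr0n addr0.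
  move=> /(_ (maxn (B f) i.+1)); apply; last by rewrite leq_max leqnn orbT.
  by rewrite -phiE // leq_max leqnn.
have V2 (f : V) : f + f = 0 by apply: phi0; rewrite phiD U2.
have phi_inj f g : phi f = phi g -> f = g.
  move=> fg; apply: (addIr g); rewrite V2; apply: phi0.
  by rewrite phiD fg U2.
have phi_surj u : exists f, phi f = u.
  have [n <-] := e_surj u; have /spanP[c ->] := e_span n.+1 n (ltnSn n).
  pose f i := if (i < n.+1)%N then c i else 0.
  have f_fin : Defs.finite_support f.
    apply: (@sub_finite_set _ _ `I_n.+1); last exact: finite_II.
    by move=> i /=; rewrite /f; case: ltnP => //; rewrite eqxx.
  exists (exist [in Defs.finite_support (A:='Z_2)] f (mem_set f_fin)).
  set g : V := exist _ _ _.
  rewrite (phiE (maxn n.+1 (B g))) ?leq_maxr //.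
  rewrite (big_ord_widen _ (fun i => b i *+ (c i : 'Z_2)) (leq_maxl n.+1 (B g))).
  rewrite [RHS]big_mkcond; apply: eq_bigr => i _; rewrite /= /f.
  by case: ltnP.
have /choice [psi psiK] := phi_surj.
have phiK f : psi (phi f) = f by apply: phi_inj; rewrite psiK.
have psiB : zmod_morphism psi.
  move=> u v; apply: phi_inj; rewrite psiK.
  have phiN f : phi (- f) = - phi f.
    by apply: (addrI (phi f)); rewrite -phiD !subrr; apply: (addrI (phi 0)); rewrite -phiD !addr0.
  by rewrite phiD phiN !psiK.
pose psiM := GRing.isZmodMorphism.Build U V psi psiB.
pose psiA : {additive U -> V} := HB.pack psi psiM.
by exists psiA, phi.
Qed.

End ElementaryAbelian.

(** * Finite quotients and the profinite completion *)

Section FiniteIndex.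
Variable H : groupType.
Implicit Types N M : finite_index_normal H.

(** Equality of [s] is a congruence with finitely many classes, so the class of 1 is a normal
    subgroup of finite index whose cosets are the classes. No group structure is required on [S]. *)
Lemma congruence_kernel (S : Type) (s : H -> S) : finite_set (range s) ->
  (forall x x' y y', s x = s x' -> s y = s y' -> s (x * y) = s (x' * y')) ->
  exists N, forall x y, N (x^-1 * y) <-> s x = s y.
Proof.
move=> s_fin sM.
have sV x : s x = s 1 -> s x^-1 = s 1.
  by move=> x1; have := sM 1 x x^-1 x^-1 (esym x1) erefl; rewrite mul1g mulgV.
pose K := [set x | s x = s 1].
have K_normal : is_normal_subgroup K.
  split; first split => // x y Kx Ky; rewrite /K /=.
    by rewrite -[1]mulg1; apply: sM => //; exact: sV.
  move=> x g Kx; rewrite /K /= conjgE.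
  have -> : s 1 = s (g^-1 * (1 * g)) by rewrite mul1g mulVg.
  by apply: (sM) => //; apply: sM.
have KP x y : K (x^-1 * y) <-> s x = s y.
  split=> [xy|xy]; rewrite /K /=.
    by have := sM x x _ _ erefl xy; rewrite mulVKg mulg1.
  by rewrite -(mulVg x); apply: sM.
pose NK := NormalSubgroup K_normal.
have fin : finite_set [set: quotient_group NK].
  apply: (@sub_finite_set _ _ ((s \o repr) @^-1` range s)) => [u _|]; first by exists (repr u).
  apply: finite_preimage => // u v _ _ /= uv.
  by rewrite -[u]reprK -[v]reprK; apply/(qproj_eq NK)/KP.
by exists (FiniteIndexNormal fin).
Qed.

Lemma finite_index_cap N M : exists K : finite_index_normal H,
  (forall x, K x -> N x) /\ (forall x, K x -> M x).
Proof.
pose s x := (qproj N x, qproj M x).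
have s_fin : finite_set (range s).
  apply: (@sub_finite_set _ _ ([set: quotient_group N] `*` [set: quotient_group M])) => //.
  by apply: finite_setX; exact: finite_indexP.
have [|K KP] := congruence_kernel s_fin.
  by move=> x x' y y' [xN xM] [yN yM]; rewrite /s !qprojM xN xM yN yM.
exists K; split=> x Kx; rewrite -[x]mul1g -[1]invg1;
  have : K (1^-1 * x) by rewrite invg1 mul1g.
  by move=> /KP[/qproj_eq].
by move=> /KP[_ /qproj_eq].
Qed.

Lemma finite_indexT : exists N, forall x, N x.
Proof.
have [|//|N NP] := @congruence_kernel unit (fun=> tt).
  by apply: (sub_finite_set _ (finite_set1 tt)) => -[].
by exists N => x; rewrite -[x]mul1g -[1]invg1; apply/NP.
Qed.

End FiniteIndex.

(** * Neighbourhoods and continuous cochains on a profinite completion *)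

Section Completion.
Variable H : groupType.
Notation pc := (profinite_completion H).
Implicit Types (N M : finite_index_normal H) (x y : pc) (g : H).

Lemma pc_of_subproof g : compatible_family (fun N => qproj N g).
Proof. by move=> N M NM k; apply: pc_compatL. Qed.

Definition pc_of g : pc := exist [in compatible_family (G:=H)] _ (mem_set (@pc_of_subproof g)).

Lemma pc_coord_of N g : pc_coord N (pc_of g) = qproj N g.
Proof. by []. Qed.

Lemma pc_coordM N x y : pc_coord N (x * y) = pc_coord N x * pc_coord N y.
Proof. by []. Qed.

Lemma pc_ofM : {morph pc_of : g h / g * h}.
Proof. by move=> g h; apply: pc_eqP => N; rewrite pc_coordM !pc_coord_of qprojM. Qed.

Lemma pc_of1 : pc_of 1 = 1.
Proof. by apply: pc_eqP => N; rewrite pc_coord_of. Qed.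

Lemma pc_coord_mono N M x y : (forall g, N g -> M g) ->
  pc_coord N x = pc_coord N y -> pc_coord M x = pc_coord M y.
Proof.
move=> NM xyN; have [g yg] := qproj_surj (pc_coord N y).
by rewrite (pc_compat NM yg); apply: (pc_compat NM); rewrite xyN.
Qed.

Lemma pc_cvg (F : set_system pc) x : Filter F ->
  (forall N, F [set y | pc_coord N y = pc_coord N x]) -> F --> x.
Proof.
move=> FF Fx A [_ [[C oC <-] Cx CA]]; apply: (filterS CA).
have FC : fmap val F --> (val x : prod_topology (fun N => finite_quotient N : topologicalType)).
  apply/cvg_sup => N B [_ [[D oD <-] Dx DB]].
  suff FD : F [set y | D (pc_coord N y)].
    exact: (@filterS _ F FF _ _ (fun y Dy => DB (val y) Dy) FD).
  by apply: filterS (Fx N) => y /= ->.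
exact: FC _ (open_nbhs_nbhs (conj oC Cx)).
Qed.

Notation power n := (prod_topology (fun _ : 'I_n => pc : topologicalType)).

Definition coord_eq n N (x y : 'I_n -> pc) : Prop :=
  forall i, pc_coord N (x i) = pc_coord N (y i).

Lemma power_cvg n (F : set_system ('I_n -> pc)) (x : power n) : Filter F ->
  (forall N, F [set y | coord_eq N y x]) -> F --> x.
Proof.
move=> FF Fx; apply/cvg_sup => i B [_ [[D oD <-] Dx DB]]; apply: (filterS DB).
have Fi : fmap (fun y : 'I_n -> pc => y i) F --> x i.
  by apply: pc_cvg => N; apply: (@filterS _ F FF _ _ _ (Fx N)) => y; exact.
exact: Fi _ (open_nbhs_nbhs (conj oD Dx)).
Qed.

Lemma power_nbhs_coord n N (x : power n) : nbhs x [set y | coord_eq N y x].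
Proof.
have := @filter_forall _ _
  (fun i (y : 'I_n -> pc) => pc_coord N (y i) = pc_coord N ((x : 'I_n -> pc) i))
  (nbhs x) (nbhs_filter x).
apply=> i; exact: (@proj_continuous _ (fun _ : 'I_n => pc : topologicalType) i x _
  (pc_coord_nbhs N (x i))).
Qed.

Lemma coord_eq_filter n (B : finite_index_normal H -> set ('I_n -> pc)) :
  (forall N M, (forall g, N g -> M g) -> B N `<=` B M) ->
  Filter (filter_from [set: finite_index_normal H] B).
Proof.
move=> B_mono; apply: filter_fromT_filter; first by have [N] := finite_indexT H; exists N.
move=> N M; have [K [KN KM]] := finite_index_cap N M.
by exists K => x Bx; split; [apply: B_mono Bx|apply: B_mono Bx].
Qed.

(** The sets [coord_eq N y x] generate a filter, the subgroups [N] being directed; it converges to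
    [x] by [power_cvg], so each neighbourhood contains one of them. *)
Lemma power_nbhsE n (x : power n) (U : set ('I_n -> pc)) : nbhs x U ->
  exists N, forall y : 'I_n -> pc, coord_eq N y x -> U y.
Proof.
move=> xU; pose B N := [set y : 'I_n -> pc | coord_eq N y x].
have FF : Filter (filter_from [set: finite_index_normal H] B).
  by apply: coord_eq_filter => N M NM y yx i; apply: pc_coord_mono (yx i).
have [|N _ NU] := @power_cvg n (filter_from [set: finite_index_normal H] B) x FF _ U xU.
  by move=> N; exists N.
by exists N => y /NU.
Qed.

Lemma power_compact n : compact [set: power n].
Proof.
have := @tychonoff 'I_n (fun=> pc : topologicalType) (fun=> setT) (fun=> @pc_compact H).
by rewrite (_ : [set f | _] = setT)//; apply/seteqP; split.
Qed.

(** Compactness: if no [N] determined [f], the sets of points where level [N] fails would generate a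
    proper filter, whereas [f] is constant near a cluster point. *)
Lemma continuous_cochain_coord (A : zmodType) n (f : cochain pc A n) :
  continuous_cochain f -> exists N, forall x y : 'I_n -> pc, coord_eq N x y -> f x = f y.
Proof.
move=> /continuous_cochainP cf; apply: contrapT => nN.
pose B N := [set x | exists2 y, coord_eq N y x & f y <> f x].
have B_mono N M : (forall g, N g -> M g) -> B N `<=` B M.
  move=> NM x [y yx fyx]; exists y => // i; exact: pc_coord_mono (yx i).
have FF : ProperFilter (filter_from [set: finite_index_normal H] B).
  apply: filter_from_proper; first exact: coord_eq_filter.
  move=> N _; apply: contrapT => /set0P/negP; rewrite negbK => /eqP BN0.
  apply: nN; exists N => x y xy; apply: contrapT => fxy.
  have : B N y by exists x.
  by rewrite BN0.
have [z [_ Fz]] := @power_compact n _ FF filterT.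
have [N Nz] := power_nbhsE (cf z).
have [] := Fz (B N) [set x | coord_eq N x z]; [by exists N|exact: power_nbhs_coord|].
move=> x [[y yx fyx] xz]; apply: fyx; rewrite (Nz x xz); apply: (Nz y) => i.
by rewrite yx xz.
Qed.

Lemma coord_continuous_cochain (A : zmodType) n N (f : cochain pc A n) :
  (forall x y : 'I_n -> pc, coord_eq N x y -> f x = f y) -> continuous_cochain f.
Proof.
move=> fN; apply/continuous_cochainP => x.
by apply: (@filterS _ _ (nbhs_filter x) _ _ _ (power_nbhs_coord N x)) => y /fN.
Qed.

Lemma pc_nbhsE x (U : set pc) : nbhs x U ->
  exists N, forall y, pc_coord N y = pc_coord N x -> U y.
Proof.
move=> xU; pose U1 := [set y : 'I_1 -> pc | U (y ord0)].
have : nbhs ((fun=> x) : power 1) U1.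
  exact: (@proj_continuous _ (fun _ : 'I_1 => pc : topologicalType) ord0 (fun=> x) U xU).
by move=> /power_nbhsE [N NU]; exists N => y yx; apply: (NU (fun=> y)).
Qed.

End Completion.

(** * Sections of tree automorphisms and of elements of the Grigorchuk group *)

Section TreeSections.
Implicit Types (g h : tree_automorphism bool) (v w : seq bool) (x y : bool).

Lemma tree_root g : g [::] = [::].
Proof. by have [_ g0 _] := set_mem (valP g); exact: g0. Qed.

Lemma tree_child g v w : child v w <-> child (g v) (g w).
Proof. by have [_ _ gc] := set_mem (valP g); exact: gc. Qed.

Lemma tree_rcons g w x : exists y, g (rcons w x) = rcons (g w) y.
Proof. by apply/(proj1 (tree_child g _ _)); exists x. Qed.

Lemma ta_mulE g h w : tree_fun (g * h) w = g (h w).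
Proof. by []. Qed.

Lemma ta_invK g w : tree_fun g^-1 (g w) = w.
Proof. by rewrite -ta_mulE mulVg. Qed.

Lemma ta_invVK g w : g (tree_fun g^-1 w) = w.
Proof. by rewrite -ta_mulE mulgV. Qed.

Definition swap g : bool := head false (g [:: false]).

Definition section_fun g x w := behead (g (x :: w)).

Lemma tree_letter g x : g [:: x] = [:: swap g (+) x].
Proof.
have letter y : exists z, g [:: y] = [:: z].
  by have [z] := tree_rcons g [::] y; rewrite tree_root; exists z.
have [z zE] := letter false; rewrite /swap zE /=.
case: x; last by rewrite addbF.
have [t tE] := letter true; rewrite tE addbT.
case: (eqVneq t z) => [tz|]; last by case: t z {zE tE} => -[].
by have := ta_invK g [:: true]; rewrite tE tz -zE ta_invK.
Qed.

(** Children go to children, so appending a letter to [w] leaves the first letter of the image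
    unchanged. *)
Lemma tree_cons g x w : g (x :: w) = (swap g (+) x) :: section_fun g x w.
Proof.
suff [w' gE] : exists w', g (x :: w) = (swap g (+) x) :: w'.
  by rewrite /section_fun gE.
elim/last_ind: w => [|w y [w' IH]]; first by exists [::]; exact: tree_letter.
have [z] := tree_rcons g (x :: w) y; rewrite IH /= => ->.
by exists (rcons w' z).
Qed.

Lemma section_funP g x : is_tree_automorphism (section_fun g x).
Proof.
have child_cons y v w : child v w <-> child (y :: v) (y :: w).
  by split=> -[z]; [move=> ->|case=> ->]; exists z.
split.
(* The inverse of the section at [x] is the section of [g^-1] at the image of [x]. *)
- exists (section_fun g^-1 (swap g (+) x)) => w.
    by rewrite {1}/section_fun -tree_cons ta_invK.
  have := tree_cons g^-1 (swap g (+) x) w.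
  have -> : swap g^-1 (+) (swap g (+) x) = x.
    have : tree_fun g^-1 (g [:: x]) = [:: x] by exact: ta_invK.
    by rewrite !tree_letter => -[].
  by move=> gE; rewrite {1}/section_fun -gE ta_invVK.
- by rewrite /section_fun tree_letter.
- move=> v w; rewrite (child_cons x) (tree_child g) !tree_cons.
  by rewrite -child_cons.
Qed.

Definition ta_section g x := mk_tree_automorphism (section_funP g x).

Lemma ta_sectionE g x w : g (x :: w) = (swap g (+) x) :: ta_section g x w.
Proof. exact: tree_cons. Qed.

Lemma swapM g h : swap (g * h) = swap g (+) swap h.
Proof. by rewrite {1}/swap ta_mulE !tree_letter /= addbF. Qed.

Lemma ta_sectionM g h x :
  ta_section (g * h) x = ta_section g (swap h (+) x) * ta_section h x.
Proof.
apply: tree_automorphismP => w.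
have := ta_mulE g h (x :: w).
by rewrite !ta_sectionE => -[].
Qed.

Lemma ta_section1 x : ta_section 1 x = 1.
Proof. exact: tree_automorphismP. Qed.

Lemma tree_automorphism_eq g h : swap g = swap h ->
  (forall x, ta_section g x = ta_section h x) -> g = h.
Proof.
move=> gh0 gh; apply: tree_automorphismP => -[|x w].
  by rewrite !tree_root.
by rewrite !ta_sectionE gh0 gh.
Qed.

Lemma ta_section_a x : ta_section grig_a x = 1.
Proof. exact: tree_automorphismP. Qed.
Lemma ta_section_b x : ta_section grig_b x = if x then grig_c else grig_a.
Proof. by apply: tree_automorphismP => w; case: x. Qed.
Lemma ta_section_c x : ta_section grig_c x = if x then grig_d else grig_a.
Proof. by apply: tree_automorphismP => w; case: x. Qed.
Lemma ta_section_d x : ta_section grig_d x = if x then grig_b else 1.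
Proof. by apply: tree_automorphismP => w; case: x. Qed.

End TreeSections.

(** * Words in the generators and self-similarity of the group *)

Section Grigorchuk.

Notation L := (bool * bool)%type.
Implicit Types (l : L) (w : seq L) (x : bool).

(** Letters are pairs of booleans: these form a finite type, as the enumeration of cochains
    requires. *)
Definition ta_gen l : tree_automorphism bool :=
  match l with
  | (false, false) => grig_a
  | (false, true) => grig_b
  | (true, false) => grig_c
  | (true, true) => grig_d
  end.

Lemma ta_gen_mem l : ta_gen l \in grigorchuk_set.
Proof.
apply/mem_set => A [_]; apply; rewrite /= /ta_gen.
by case: l => -[] []; do ?[by right | left].
Qed.

Definition gen l : grigorchuk := exist [in grigorchuk_set] _ (ta_gen_mem l).

Definition ev w : grigorchuk := \prod_(l <- w) gen l.

Lemma ev_cat u w : ev (u ++ w) = ev u * ev w.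
Proof. exact: big_cat. Qed.

Lemma ev_cons l w : ev (l :: w) = gen l * ev w.
Proof. exact: big_cons. Qed.

Lemma ev_nil : ev [::] = 1.
Proof. exact: big_nil. Qed.

Lemma gen_sq l : gen l * gen l = 1.
Proof.
apply/val_inj; rewrite gmulfM gmulf1 /=.
apply: tree_automorphismP => w; have [bK cK dK] := grig_bcd_funK w.
case: l => -[] []; [exact: dK|exact: cK|exact: bK|].
by case: w {bK cK dK} => //= -[].
Qed.

Lemma ev_rev w : ev (rev w) = (ev w)^-1.
Proof.
elim: w => [|l w IH]; first by rewrite ev_nil invg1.
rewrite rev_cons -cats1 ev_cat IH !ev_cons ev_nil mulg1 invgM.
by congr (_ * _); apply: (mulgI (gen l)); rewrite gen_sq mulgV.
Qed.

Lemma ev_surj (g : grigorchuk) : exists w, g = ev w.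
Proof.
suff [w wE] : exists w, val (ev w) = val g by exists w; apply/val_inj.
(* The elements represented by words form a subgroup: generators are involutions, so reversed words
   give inverses. *)
apply: (set_mem (valP g) [set f | exists w, val (ev w) = f]); split.
  split; first by exists [::]; rewrite ev_nil.
  move=> _ _ [u <-] [w <-]; exists (u ++ rev w).
  by rewrite ev_cat ev_rev gmulfM gmulfV.
move=> f fS; suff [l ->] : exists l, f = ta_gen l.
  by exists [:: l]; rewrite ev_cons ev_nil mulg1.
by case: fS => [[[]|]|] ->; [exists (false, false)|exists (false, true)
  |exists (true, false)|exists (true, true)].
Qed.

Lemma grigorchuk_ind (P : grigorchuk -> Prop) : P 1 ->
  (forall l g, P g -> P (gen l * g)) -> forall g, P g.
Proof.
move=> P1 PM g; have [w ->] := ev_surj g.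
elim: w => [|l w IH]; first by rewrite ev_nil.
by rewrite ev_cons; apply: PM.
Qed.

Lemma ta_section_gen l x : ta_section (ta_gen l) x \in grigorchuk_set.
Proof.
have mem1 : (1 : tree_automorphism bool) \in grigorchuk_set.
  by apply/mem_set; case: (generated_is_subgroup [set grig_a; grig_b; grig_c; grig_d]).
case: l => -[] []; rewrite /= ?ta_section_a ?ta_section_b ?ta_section_c ?ta_section_d;
  case: x => //; by [exact: (ta_gen_mem (false, false)) | exact: (ta_gen_mem (false, true)) |
  exact: (ta_gen_mem (true, false)) | exact: (ta_gen_mem (true, true))].
Qed.

Lemma ta_section_mem (g : grigorchuk) x : ta_section (val g) x \in grigorchuk_set.
Proof.
elim/grigorchuk_ind: g x => [x|l g IH x].
  by rewrite gmulf1 ta_section1; apply: (valP (1 : grigorchuk)).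
rewrite gmulfM ta_sectionM.
exact: (valP ((exist [in grigorchuk_set] _ (ta_section_gen l (swap (val g) (+) x)) : grigorchuk) *
  (exist [in grigorchuk_set] _ (IH x) : grigorchuk))).
Qed.

End Grigorchuk.

(** * The dihedral quotient of order 16 *)

Section SelfSimilar.
Implicit Types (g h : grigorchuk) (x y : bool) (k : nat).

Definition sw g : bool := swap (val g).
Definition sec g x : grigorchuk := exist [in grigorchuk_set] _ (ta_section_mem g x).

Arguments sw : simpl never.
Arguments sec : simpl never.

Lemma val_sec g x : val (sec g x) = ta_section (val g) x.
Proof. by []. Qed.

Lemma swM g h : sw (g * h) = sw g (+) sw h.
Proof. by rewrite /sw gmulfM swapM. Qed.

Lemma sw1 : sw 1 = false. Proof. by rewrite /sw gmulf1. Qed.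

Lemma secM g h x : sec (g * h) x = sec g (sw h (+) x) * sec h x.
Proof. by apply/val_inj; rewrite gmulfM !val_sec gmulfM ta_sectionM. Qed.

Lemma sec1 x : sec 1 x = 1.
Proof. by apply/val_inj; rewrite val_sec !gmulf1 ta_section1. Qed.

Lemma grigorchuk_eq g h : sw g = sw h -> sec g false = sec h false ->
  sec g true = sec h true -> g = h.
Proof.
move=> ghs gh0 gh1; apply/val_inj/tree_automorphism_eq => // x.
by case: x; [move/(congr1 val): gh1|move/(congr1 val): gh0].
Qed.

Notation a := (gen (false, false)).
Notation b := (gen (false, true)).
Notation c := (gen (true, false)).
Notation d := (gen (true, true)).

Lemma sw_gen l : sw (gen l) = (l == (false, false)).
Proof. by case: l => -[] []. Qed.

Lemma sec_a x : sec a x = 1.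
Proof. by apply/val_inj; rewrite val_sec gmulf1 ta_section_a. Qed.
Lemma sec_b x : sec b x = if x then c else a.
Proof. by apply/val_inj; rewrite val_sec ta_section_b; case: x. Qed.
Lemma sec_c x : sec c x = if x then d else a.
Proof. by apply/val_inj; rewrite val_sec ta_section_c; case: x. Qed.
Lemma sec_d x : sec d x = if x then b else 1.
Proof. by apply/val_inj; rewrite val_sec ta_section_d; case: x; rewrite ?gmulf1. Qed.

Definition sec_gen := (sec_a, sec_b, sec_c, sec_d).

Lemma sw_exp g n : sw g = false -> sw (g ^+ n) = false.
Proof. by move=> g0; elim: n => [|n IH]; rewrite ?sw1 // expgS swM g0 IH. Qed.

Lemma sec_exp g n x : sw g = false -> sec (g ^+ n) x = sec g x ^+ n.
Proof.
move=> g0; elim: n => [|n IH]; first by rewrite sec1.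
by rewrite !expgS secM sw_exp // IH.
Qed.

Lemma exp_eq1 g n : sw g = false -> sec g false ^+ n = 1 -> sec g true ^+ n = 1 ->
  g ^+ n = 1.
Proof.
move=> g0 gf gt.
by apply: grigorchuk_eq; rewrite ?sw_exp ?sw1 // sec_exp // sec1.
Qed.

(** Parity of the number of vertices of level [n] at which the section of [g] swaps the letters. *)
Fixpoint activity n g : bool :=
  if n is m.+1 then activity m (sec g false) (+) activity m (sec g true) else sw g.

(** [h] only permutes the vertices, so the contributions of [g] are added in another order. *)
Lemma activityM n g h : activity n (g * h) = activity n g (+) activity n h.
Proof.
elim: n g h => [|n IH] g h /=; first exact: swM.
rewrite !secM !IH addbF addbT.
by case: (sw h) => /=; do 4!case: (activity _ _).
Qed.

Lemma activity1 n : activity n 1 = false.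
Proof. by elim: n => [|n IH] /=; rewrite ?sw1 // !sec1 IH. Qed.

Arguments activity : simpl never.

(* The action of G on the vertices of level 2, each doubled by the action of
   its section on Z/2 through the activity at level 2. *)
Definition octagon_act g (p : bool * bool * bool) : bool * bool * bool :=
  let: (x, y, e) := p in
  (sw g (+) x, sw (sec g x) (+) y, activity 2 (sec (sec g x) y) (+) e).

Lemma octagon_actM g h p :
  octagon_act (g * h) p = octagon_act g (octagon_act h p).
Proof. by case: p => [[x y] e] /=; rewrite !secM !swM !activityM !addbA. Qed.

(* The labels of the 8 points for which G acts by the symmetries of an octagon. *)
Definition octagon_label (p : bool * bool * bool) : nat :=
  match p with
  | (true, false, false) => 0
  | (false, true, false) => 1
  | (true, true, true) => 2
  | (false, false, true) => 3
  | (true, false, true) => 4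
  | (false, true, true) => 5
  | (true, true, false) => 6
  | (false, false, false) => 7
  end.

Definition octagon_point (k : nat) : bool * bool * bool :=
  nth (true, false, false)
    [:: (true, false, false); (false, true, false); (true, true, true);
        (false, false, true); (true, false, true); (false, true, true);
        (true, true, false); (false, false, false)] k.

Lemma octagon_labelK p : octagon_point (octagon_label p) = p.
Proof. by case: p => -[] [] [] []. Qed.

(* [(e, i)] is the symmetry [k |-> i + k] or, if [e] holds, [k |-> i - k]. *)
Definition dihedral : seq (bool * nat) :=
  [seq (e, i) | e <- [:: false; true], i <- iota 0 8].

Definition dihedral_act (m : bool * nat) (k : nat) : nat :=
  ((if m.1 then 8 - k else k) + m.2) %% 8.

Definition dihedral_mul (m m' : bool * nat) : bool * nat :=
  (m.1 (+) m'.1, dihedral_act m m'.2).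

(* [(e, i)] with [i < 8] lifts to the same symmetry of the 16-gon; the product
   of two lifts differs from the lift of the product by the central rotation by 8
   exactly when [carry] holds. *)
Definition carry (m m' : bool * nat) : bool :=
  8 <= ((if m.1 then 16 - m'.2 else m'.2) + m.2) %% 16.

(** A symmetry of the octagon is known from the images [i], [j] of 0 and 1: it is a rotation exactly
    when [j] follows [i]. *)
Definition dihedral_of_images (i j : nat) : bool * nat := (j != i.+1 %% 8, i).

Definition dihedral_image g : bool * nat :=
  dihedral_of_images (octagon_label (octagon_act g (octagon_point 0)))
                     (octagon_label (octagon_act g (octagon_point 1%N))).

Arguments dihedral_image : simpl never.

Lemma dihedral_imageE g m : m \in dihedral ->
  (forall k, k \in iota 0 8 ->
     octagon_label (octagon_act g (octagon_point k)) = dihedral_act m k) ->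
  dihedral_image g = m.
Proof.
move=> mD gE; rewrite /dihedral_image !gE //; apply/eqP; move: m mD {gE}.
by apply/allP.
Qed.

(** The generators a and b go to reflections whose product is the rotation by 7, of order 8. *)
Definition gen_dihedral (l : bool * bool) : bool * nat :=
  match l with
  | (false, false) => (true, 7)
  | (true, true) => (false, 0)
  | _ => (true, 0)
  end.

Lemma iota8_ind (P : nat -> Prop) : P 0 -> P 1%N -> P 2 -> P 3 -> P 4 -> P 5 -> P 6 -> P 7 ->
  forall k, k \in iota 0 8 -> P k.
Proof. by move=> ? ? ? ? ? ? ? ?; do 8?[case=> //]. Qed.

Lemma dihedral_act_gen l k : k \in iota 0 8 ->
  octagon_label (octagon_act (gen l) (octagon_point k)) = dihedral_act (gen_dihedral l) k.
Proof.
by move: k; apply: iota8_ind; case: l => -[] []; rewrite /octagon_act /=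
   ?(sec_gen, sec1, sw1, sw_gen, activity1) /activity
    ?(sec_gen, sec1, sw1, sw_gen).
Qed.

Lemma dihedral_actM m m' k : m \in dihedral -> m' \in dihedral -> k \in iota 0 8 ->
  dihedral_act m (dihedral_act m' k) = dihedral_act (dihedral_mul m m') k.
Proof.
suff /allP chk : all (fun m => all (fun m' => all (fun k =>
  dihedral_act m (dihedral_act m' k) == dihedral_act (dihedral_mul m m') k)
  (iota 0 8)) dihedral) dihedral.
  by move=> /chk /allP chk1 /chk1 /allP chk2 /chk2 /eqP.
by vm_compute.
Qed.

Lemma dihedral_mul_mem m m' : m \in dihedral -> m' \in dihedral ->
  dihedral_mul m m' \in dihedral.
Proof.
suff /allP chk : all (fun m => all (fun m' => dihedral_mul m m' \in dihedral) dihedral) dihedral.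
  by move=> /chk /allP; exact.
by vm_compute.
Qed.

Lemma dihedral_act_mem m k : dihedral_act m k \in iota 0 8.
Proof. by rewrite mem_iota ltn_mod. Qed.

(** Induction on words: the generators act by symmetries of the octagon, and these are closed under
    composition. *)
Lemma dihedral_image_act g : dihedral_image g \in dihedral /\
  (forall k, k \in iota 0 8 ->
     octagon_label (octagon_act g (octagon_point k)) = dihedral_act (dihedral_image g) k).
Proof.
suff [m mD mE] : exists2 m, m \in dihedral & forall k, k \in iota 0 8 ->
    octagon_label (octagon_act g (octagon_point k)) = dihedral_act m k.
  by rewrite (dihedral_imageE mD mE).
elim/grigorchuk_ind: g => [|l g [m mD mE]].
  by exists (false, 0); last (apply: iota8_ind).
have lD : gen_dihedral l \in dihedral by case: l => -[] [].
exists (dihedral_mul (gen_dihedral l) m); first exact: dihedral_mul_mem.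
move=> k k8; rewrite octagon_actM -dihedral_actM // -(mE k k8).
by rewrite -[in LHS](octagon_labelK (octagon_act g _)) dihedral_act_gen // mE // dihedral_act_mem.
Qed.

Lemma dihedral_imageM g h :
  dihedral_image (g * h) = dihedral_mul (dihedral_image g) (dihedral_image h).
Proof.
have [gD gE] := dihedral_image_act g; have [hD hE] := dihedral_image_act h.
apply: dihedral_imageE => [|k k8]; first exact: dihedral_mul_mem.
rewrite octagon_actM -dihedral_actM // -(hE k k8).
by rewrite -[in LHS](octagon_labelK (octagon_act h _)) gE // hE // dihedral_act_mem.
Qed.

Lemma dihedral_image_gen l : dihedral_image (gen l) = gen_dihedral l.
Proof.
apply: dihedral_imageE => [|k]; last exact: dihedral_act_gen.
by case: l => -[] [].
Qed.

Lemma dihedral_image1 : dihedral_image 1 = (false, 0).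
Proof.
by apply: dihedral_imageE; last (apply: iota8_ind).
Qed.

End SelfSimilar.

(** * The cocycles and their restrictions to cyclic groups *)

Section Cocycles.
Variable H : groupType.
Implicit Types (f : H -> H -> bool) (x y z : H).

Definition cocycle2 f : Prop :=
  forall x y z, f y z (+) f (x * y) z (+) f x (y * z) (+) f x y = false.

Definition coboundary2 f : Prop :=
  exists h : H -> bool, forall x y, f x y = h x (+) h y (+) h (x * y).

(** Such an [f] comes from a finite quotient of [H]; the compatible map [s] stands for that
    quotient, which [congruence_kernel] recovers. *)
Definition finite_level f : Prop :=
  exists (S : finType) (s : H -> S),
    (forall x x' y y', s x = s x' -> s y = s y' -> s (x * y) = s (x' * y')) /\
    (forall x x' y y', s x = s x' -> s y = s y' -> f x y = f x' y').

(* For a cocycle [f] and [y ^+ n = 1], this is the restriction of its class to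
   H^2(Z/n, Z/2), the cyclic group being generated by [y]. *)
Definition cyclic_sum n f y : bool := \big[addb/false]_(i < n) f y (y ^+ i).

Lemma cyclic_sumD n f f' y :
  cyclic_sum n (fun x z => f x z (+) f' x z) y = cyclic_sum n f y (+) cyclic_sum n f' y.
Proof. exact: big_split. Qed.

(** The sum telescopes to [n] copies of [h y], which cancel as [n] is even, plus [h 1] and
    [h (y ^+ n)], which agree. *)
Lemma cyclic_sum_coboundary n f y : coboundary2 f -> ~~ odd n -> y ^+ n = 1 ->
  cyclic_sum n f y = false.
Proof.
move=> [h fE] /negPf n_even yn1.
have telescope m : cyclic_sum m f y = (odd m && h y) (+) h 1 (+) h (y ^+ m).
  elim: m => [|m]; rewrite /cyclic_sum; first by rewrite big_ord0 /= addbb.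
  rewrite big_ord_recr /= => ->; rewrite fE expgS.
  by case: (odd m); case: (h y); case: (h 1); case: (h (y ^+ m)); case: (h _).
by rewrite telescope n_even yn1 addbb.
Qed.

Lemma cyclic_sum_double n f y : y ^+ n = 1 -> cyclic_sum (n + n) f y = false.
Proof.
move=> yn1; rewrite /cyclic_sum big_split_ord /=.
rewrite [X in _ (+) X](_ : _ = \big[addb/false]_(i < n) f y (y ^+ i)) ?addbb //.
by apply: eq_bigr => i _; rewrite expgnDr yn1 mul1g.
Qed.

End Cocycles.

(** * The transfer and the family of carry cocycles *)

Section CarryCocycles.
Implicit Types (f : grigorchuk -> grigorchuk -> bool) (g h k : grigorchuk).

(* The transfer, from the stabiliser of the first level, of the pull-back of [f]
   along the section at a vertex. *)
Definition transfer f g h : bool :=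
  f (sec g (sw h)) (sec h false) (+) f (sec g (~~ sw h)) (sec h true).

(** This is the sum of two identities for [f], one for each letter; if [z] swaps the letters, they
    contain the two summands of [transfer f x y] in exchanged order. *)
Lemma transfer_cocycle f : cocycle2 f -> cocycle2 (transfer f).
Proof.
move=> fZ x y z; rewrite /transfer !swM !secM addbF addbT addbN.
have /esym h0 := fZ (sec x (sw y (+) sw z)) (sec y (sw z)) (sec z false).
have /esym h1 := fZ (sec x (~~ (sw y (+) sw z))) (sec y (~~ sw z)) (sec z true).
move: h0 h1; case: (sw z) => /=; rewrite ?addbF ?addbT ?negbK;
  by do 8!case: (f _ _).
Qed.

Lemma transfer_finite_level f : finite_level f -> finite_level (transfer f).
Proof.
move=> [S [s [sM sf]]]; exists (bool * S * S)%type,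
  (fun g => (sw g, s (sec g false), s (sec g true))).
split=> x x' y y' [xx' xf xt] [yy' yf yt].
  rewrite !swM !secM xx' yy' !addbF !addbT; case: (sw y') => /=;
  by congr (_, _, _); apply: sM.
rewrite /transfer yy'; congr (_ (+) _); apply: sf => //; by case: (sw y').
Qed.

Definition carry_cocycle0 g h : bool := carry (dihedral_image g) (dihedral_image h).

(** This expresses associativity in the symmetry group of the 16-gon, checked on all triples. *)
Lemma carry_cocycle0P : cocycle2 carry_cocycle0.
Proof.
move=> x y z; rewrite /carry_cocycle0 !dihedral_imageM.
have [/= + _] := dihedral_image_act x; have [/= + _] := dihedral_image_act y.
have [/= + _] := dihedral_image_act z.
move: (dihedral_image x) (dihedral_image y) (dihedral_image z) => m1 m2 m3 h3 h2 h1.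
suff /allP chk : all (fun m1 => all (fun m2 => all (fun m3 =>
  carry m2 m3 (+) carry (dihedral_mul m1 m2) m3 (+) carry m1 (dihedral_mul m2 m3) (+)
  carry m1 m2 == false) dihedral) dihedral) dihedral.
  by have /allP chk1 := chk _ h1; have /allP chk2 := chk1 _ h2; exact/eqP/(chk2 _ h3).
by vm_compute.
Qed.

Lemma carry_cocycle0_finite_level : finite_level carry_cocycle0.
Proof.
(* [inord] loses nothing, the second component being below 8. *)
pose s g := ((dihedral_image g).1, inord (dihedral_image g).2 : 'I_8).
have sE g g' : s g = s g' -> dihedral_image g = dihedral_image g'.
  have lt8 x : (dihedral_image x).2 < 8.
    have [/allpairsP [[e i] [_ + ->]] _] := dihedral_image_act x.
    by rewrite mem_iota.
  rewrite [dihedral_image g]surjective_pairing [dihedral_image g']surjective_pairing => sgg'.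
  have := congr1 fst sgg'; have := congr1 (fun p => val p.2) sgg'.
  by rewrite /s /= !inordK ?lt8 // => -> ->.
exists (bool * 'I_8)%type, s; split=> x x' y y' /sE xx' /sE yy'.
  by rewrite /s !dihedral_imageM xx' yy'.
by rewrite /carry_cocycle0 xx' yy'.
Qed.

Definition carry_cocycle n : grigorchuk -> grigorchuk -> bool :=
  iter n transfer carry_cocycle0.

Lemma carry_cocycleP n : cocycle2 (carry_cocycle n).
Proof. elim: n => [|n IH]; [exact: carry_cocycle0P|exact: transfer_cocycle]. Qed.

Lemma carry_cocycle_finite_level n : finite_level (carry_cocycle n).
Proof.
elim: n => [|n IH]; first exact: carry_cocycle0_finite_level.
exact: transfer_finite_level.
Qed.

Lemma carry_cocycle11 n : carry_cocycle n 1 1 = false.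
Proof.
elim: n => [|n IH]; first by rewrite /= /carry_cocycle0 dihedral_image1.
by rewrite /= /transfer !sec1 addbb.
Qed.

Lemma cyclic_sum_transfer n f g : sw g = false ->
  cyclic_sum n (transfer f) g = cyclic_sum n f (sec g false) (+) cyclic_sum n f (sec g true).
Proof.
move=> g0; rewrite /cyclic_sum -big_split; apply: eq_bigr => i _.
by rewrite /transfer sw_exp // !sec_exp.
Qed.

(** The sum tells whether the eighth power of the lift to the 16-gon is the central rotation; that
    power is trivial for reflections and for rotations by an even index. *)
Lemma cyclic_sum_carry_even g : ~~ odd (dihedral_image g).2 ->
  cyclic_sum 8 carry_cocycle0 g = false.
Proof.
have imX i : dihedral_image (g ^+ i) = iter i (dihedral_mul (dihedral_image g)) (false, 0).
  elim: i => [|i IH]; first exact: dihedral_image1.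
  by rewrite expgS dihedral_imageM IH.
rewrite /cyclic_sum /carry_cocycle0; under eq_bigr do rewrite imX.
have [+ _] := dihedral_image_act g; move: (dihedral_image g) => m mD m_even.
suff /allP/(_ m mD) : all (fun m => ~~ odd m.2 ==> ~~ \big[addb/false]_(i <- iota 0 8)
    carry m (iter i (dihedral_mul m) (false, 0))) dihedral.
  by rewrite m_even -[iota 0 8]/(index_iota 0 8) big_mkord => /negbTE.
by rewrite unlock; vm_compute.
Qed.

End CarryCocycles.

(** * Lysenok's substitution and the test words *)

Section TestWords.
Notation L := (bool * bool)%type.
Implicit Types (l : L) (w : seq L) (x : bool).

Notation la := ((false, false) : L).
Notation lb := ((false, true) : L).
Notation lc := ((true, false) : L).
Notation ld := ((true, true) : L).

Definition lysenok_letter l : seq L :=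
  match l with
  | (false, false) => [:: la; lc; la]
  | (false, true) => [:: ld]
  | (true, false) => [:: lb]
  | (true, true) => [:: lc]
  end.

Definition lysenok w : seq L := flatten (map lysenok_letter w).

Lemma lysenok_cons l w : ev (lysenok (l :: w)) = ev (lysenok_letter l) * ev (lysenok w).
Proof. by rewrite /lysenok /= ev_cat. Qed.

Lemma sw_lysenok w : sw (ev (lysenok w)) = false.
Proof.
elim: w => [|l w IH]; first by rewrite ev_nil sw1.
by rewrite lysenok_cons swM IH; case: l => -[] []; rewrite /= !ev_cons ev_nil !swM !sw_gen sw1.
Qed.

Lemma sec_lysenok_true w : sec (ev (lysenok w)) true = ev w.
Proof.
elim: w => [|l w IH]; first by rewrite ev_nil sec1.
rewrite lysenok_cons secM sw_lysenok addFb IH ev_cons; congr (_ * _).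
by case: l => -[] [];
    rewrite /= !ev_cons ev_nil !secM ?swM ?sw_gen ?sw1 !sec_gen sec1 ?mulg1 ?mul1g.
Qed.

(** The section is a product of copies of a and d, so its own sections are 1 or b, as [D] records.
    Its square fixes the first level with sections 1 or b, and hence squares to 1. *)
Lemma sec_lysenok_false w : sec (ev (lysenok w)) false ^+ 4 = 1.
Proof.
pose D g := forall x, sec g x = 1 \/ sec g x = gen lb.
have bb : gen lb * gen lb = 1 := gen_sq lb.
have b4 : gen lb ^+ 4 = 1 by rewrite (expgnDr (gen lb) 2 2) expg2 bb mulg1.
have D4 g : D g -> g ^+ 4 = 1.
  move=> Dg; rewrite (expgnA g 2 2); apply: exp_eq1; rewrite expg2 ?swM ?addbb // secM;
    by case: (sw g); case: (Dg false) => E0; case: (Dg true) => E1;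
    rewrite /= ?E0 ?E1 ?mulg1 ?mul1g ?bb ?expg2 ?mulg1 ?bb.
apply: D4; elim: w => [|l w IH] x; first by left; rewrite ev_nil !sec1.
rewrite lysenok_cons secM sw_lysenok addFb.
have -> : sec (ev (lysenok_letter l)) false =
    match l with (false, false) => gen ld | (false, true) => 1 | _ => gen la end.
  by case: l => -[] [];
    rewrite /= !ev_cons ev_nil !secM ?swM ?sw_gen ?sw1 !sec_gen sec1 ?mulg1 ?mul1g.
case: l => -[] [] /=; rewrite ?mul1g ?secM ?sec_gen ?mul1g; try exact: IH.
case: (_ (+) _); last by rewrite mul1g; exact: IH.
by case: (IH x) => ->; rewrite ?mulg1 ?bb; [right|left].
Qed.

Definition test_word m : seq L := iter m lysenok [:: la; lc].

Lemma test_word_exp m : ev (test_word m) ^+ 8 = 1.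
Proof.
elim: m => [|m IH].
  have bb : gen lb * gen lb = 1 := gen_sq lb.
  rewrite (expgnA _ 2 4) !ev_cons ev_nil mulg1 expg2.
  (* [g] is the square of ac, with sections da and ad; the squares of these have both sections equal
     to b. *)
  set g := (X in X ^+ 4).
  have g0 : sw g = false by rewrite !swM !sw_gen.
  have gf : sec g false = gen ld * gen la by rewrite !(secM, swM, sec_gen, sw_gen) /= !mul1g.
  have gt : sec g true = gen la * gen ld by rewrite !(secM, swM, sec_gen, sw_gen) /= !mul1g.
  have exp4 (x : grigorchuk) : (x * x) ^+ 2 = 1 -> x ^+ 4 = 1.
    by rewrite -expg2 -expgnA.
  by apply: exp_eq1; rewrite ?gf ?gt //; apply: exp4; apply: exp_eq1;
    rewrite ?(secM, swM, sec_gen, sw_gen) //= ?mul1g ?mulg1 expg2 bb.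
apply: exp_eq1; rewrite /= ?sw_lysenok ?sec_lysenok_true //.
by rewrite (expgnA _ 4 2) sec_lysenok_false expg1n.
Qed.

(** The section at 0 has exponent 4, so its sum of length 8 counts each term twice; only the section
    at 1 contributes. *)
Lemma cyclic_sum_lysenok f w :
  cyclic_sum 8 (transfer f) (ev (lysenok w)) = cyclic_sum 8 f (ev w).
Proof.
rewrite cyclic_sum_transfer ?sw_lysenok // sec_lysenok_true.
by rewrite (@cyclic_sum_double _ 4) ?sec_lysenok_false.
Qed.

Lemma cyclic_sum_test_word n m : cyclic_sum 8 (carry_cocycle n) (ev (test_word (n + m))) = (m == 0).
Proof.
elim: n => [|n IH]; last by rewrite addSn -IH; exact: cyclic_sum_lysenok.
rewrite add0n; case: m => [|m].
  (* The image of ac is the rotation by 7, whose lift to the 16-gon has order 16. *)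
  rewrite /cyclic_sum /carry_cocycle /= /carry_cocycle0.
  have im i : dihedral_image (ev [:: la; lc] ^+ i) = iter i (dihedral_mul (false, 7)) (false, 0).
    elim: i => [|i IH]; first exact: dihedral_image1.
    by rewrite expgS dihedral_imageM IH !ev_cons ev_nil mulg1 dihedral_imageM !dihedral_image_gen.
  have im1 : dihedral_image (ev [:: la; lc]) = (false, 7) by exact: (im 1%N).
  by rewrite im1; under eq_bigr do rewrite im; rewrite !big_ord_recr big_ord0.
(* The substitution sends each letter to a word of even index: aca gives [(true, 6)], the others
   have index 0. *)
apply: cyclic_sum_carry_even; rewrite -[test_word _]/(lysenok (test_word m)).
elim: (test_word m) => [|l w IH].
  by rewrite ev_nil dihedral_image1.
rewrite lysenok_cons dihedral_imageM.
have evenM (p q : bool * nat) : ~~ odd p.2 -> ~~ odd q.2 -> ~~ odd (dihedral_mul p q).2.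
  move=> /negPf pe /negPf qe; rewrite /= /dihedral_act odd_mod // oddD pe addbF.
  (* If [q.2] exceeds 8, the truncated difference [8 - q.2] is 0, which is still even. *)
  case: (p.1); last by rewrite qe.
  case: (leqP q.2 8) => [q8|/ltnW/eqP -> //]; by rewrite oddB // qe.
apply: evenM => //; case: l => -[] [];
  by rewrite [lysenok_letter _]/= !ev_cons ev_nil !dihedral_imageM !dihedral_image_gen dihedral_image1.
Qed.

(** At [test_word n] the sum is nonzero for [carry_cocycle n] and zero for [carry_cocycle m], as
    [n - m] is positive; a coboundary would give zero in total. *)
Lemma carry_cocycle_separated m n : m < n ->
  ~ coboundary2 (fun g h => carry_cocycle m g h (+) carry_cocycle n g h).
Proof.
move=> mn cob.
have := @cyclic_sum_coboundary _ 8 _ (ev (test_word (n + 0))) cob isT (test_word_exp _).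
rewrite cyclic_sumD cyclic_sum_test_word -[n in n + 0](subnKC (ltnW mn)).
rewrite -addnA cyclic_sum_test_word.
by rewrite addn0 subn_eq0 leqNgt mn.
Qed.

End TestWords.

(** * Splitting cocycles over free profinite groups *)

Section FreeLift.
Variables (X : choiceType) (K : groupType) (f : X -> K).

Definition letter_value (l : letter X) : K := if l.2 then (f l.1)^-1 else f l.1.

Definition free_lift (w : free_group X) : K := \prod_(l <- free_word w) letter_value l.

Lemma letter_value_linv (l : letter X) : letter_value (linv l) = (letter_value l)^-1.
Proof. by case: l => x []; rewrite /letter_value /= ?invgK. Qed.

Lemma free_liftM : {morph free_lift : u v / u * v}.
Proof.
move=> [u ru] [v rv]; rewrite /free_lift /=; elim: u {ru} => [|l u IH] /=.
  by rewrite big_nil mul1g.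
rewrite big_cons -mulgA -IH; case: (reduced_cat u v) => [|l' w] /=.
  by rewrite !big_cons big_nil.
case: eqP => [->|_]; rewrite !big_cons //.
by rewrite letter_value_linv mulVKg.
Qed.

End FreeLift.

Definition free_gen (X : choiceType) (x : X) : free_group X :=
  @FreeGroup X [:: (x, false)] isT.

Lemma free_lift_unique (X : choiceType) (K : groupType) (phi : free_group X -> K) :
  {morph phi : u v / u * v} -> forall w, phi w = free_lift (phi \o @free_gen X) w.
Proof.
move=> phiM; have phi1 : phi 1 = 1 by apply: (mulgI (phi 1)); rewrite -phiM !mulg1.
have phiV w : phi w^-1 = (phi w)^-1.
  by apply: (mulgI (phi w)); rewrite -phiM !mulgV.
move=> [w rw]; rewrite /free_lift /=; elim: w rw => [|l w IH] rw.
  by rewrite big_nil -phi1; congr phi; apply/val_inj.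
have rw' : reduced w by case/andP: rw.
pose ll : free_group X := @FreeGroup X [:: l] isT.
have llE : phi ll = letter_value (phi \o @free_gen X) l.
  case: l @ll {rw} => x [] //=; rewrite /letter_value /= -phiV; congr phi; exact/val_inj.
rewrite big_cons -(IH rw') -llE -phiM; congr phi; apply/val_inj => /=.
by case: w {IH rw'} rw => //= l' w /andP[/negPf ->].
Qed.

(** * The central extension defined by a normalized cocycle *)

Section Extension.
Variable H : groupType.

Record normalized_cocycle := NormalizedCocycle {
  ncocycle :> H -> H -> bool;
  ncocycleP : cocycle2 ncocycle;
  ncocycle11 : ncocycle 1 1 = false }.

Variable f : normalized_cocycle.

Lemma ncocycle_1l x : f 1 x = false.
Proof.
by have := ncocycleP f 1 1 x; rewrite !mul1g ncocycle11 addbF addbb.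
Qed.

Lemma ncocycle_1r x : f x 1 = false.
Proof.
by have := ncocycleP f x 1 1; rewrite !mulg1 ncocycle11; case: (f x 1).
Qed.

(** The carrier is the same for all cocycles; the argument keeps their group laws apart. *)
Definition extension of normalized_cocycle : Type := (H * bool)%type.
HB.instance Definition _ := Choice.on (extension f).

Definition ext_one : extension f := (1, false).
Definition ext_mul (u v : extension f) : extension f := (u.1 * v.1, u.2 (+) v.2 (+) f u.1 v.1).
Definition ext_inv (u : extension f) : extension f := (u.1^-1, u.2 (+) f u.1 u.1^-1).

Lemma ext_mulA : associative ext_mul.
Proof.
move=> [x s] [y t] [z r]; congr (_, _); rewrite /= ?mulgA //.
have := ncocycleP f x y z; move: (f y z) (f (x * y) z) (f x (y * z)) (f x y).
by case: s; case: t; case: r; do 4!case.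
Qed.
Lemma ext_mul1 : left_id ext_one ext_mul.
Proof. by move=> [x s]; rewrite /ext_mul /= mul1g ncocycle_1l addbF. Qed.
Lemma ext_mulr1 : right_id ext_one ext_mul.
Proof. by move=> [x s]; rewrite /ext_mul /= mulg1 ncocycle_1r !addbF. Qed.
Lemma ext_mulrV : right_inverse ext_one ext_inv ext_mul.
Proof. by move=> [x s]; rewrite /ext_mul /= mulgV addbA addbb addbb. Qed.
Lemma ext_mulV : left_inverse ext_one ext_inv ext_mul.
Proof.
move=> [x s]; rewrite /ext_mul /= mulVg; congr (_, _).
have := ncocycleP f x x^-1 x; rewrite mulgV mulVg ncocycle_1l ncocycle_1r.
by case: s; case: (f _ _); case: (f _ _).
Qed.

HB.instance Definition _ := isGroup.Build (extension f)
  ext_mulA ext_mul1 ext_mulr1 ext_mulV ext_mulrV.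

End Extension.

(** Freeness lifts [phi] to the extension defined by [f]; the second component of the lift is the
    splitting function. *)
Lemma free_cocycle_splits (X : choiceType) (H : groupType) (phi : free_group X -> H)
    (f : normalized_cocycle H) : {morph phi : u v / u * v} ->
  exists h : free_group X -> bool, forall u v, f (phi u) (phi v) = h u (+) h v (+) h (u * v).
Proof.
move=> phiM; pose lift x : extension f := (phi (free_gen x), false).
have lift1 u : (free_lift lift u).1 = phi u.
  have projM : {morph (fun u => (free_lift lift u).1) : u v / u * v}.
    by move=> x y; rewrite free_liftM.
  rewrite (free_lift_unique projM) (free_lift_unique phiM).
  rewrite /free_lift; apply: eq_bigr => -[x b] _; rewrite /letter_value /=.
  by rewrite /free_lift /= big_seq1.
exists (fun u => (free_lift lift u).2) => u v.
rewrite free_liftM /= !lift1.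
by case: (f _ _); case: (_.2); case: (_.2).
Qed.

(** A cocycle of finite level depends only on cosets modulo some [N], so it extends through
    representatives of the coordinates at [N]. *)
Lemma cocycle_completion (H : groupType) (f : H -> H -> bool) :
  cocycle2 f -> finite_level f -> f 1 1 = false ->
  exists (fc : normalized_cocycle (profinite_completion H)) (N : finite_index_normal H),
    (forall x x' y y', pc_coord N x = pc_coord N x' -> pc_coord N y = pc_coord N y' ->
       fc x y = fc x' y') /\ forall g h : H, fc (pc_of g) (pc_of h) = f g h.
Proof.
move=> fZ [S [s [sM sf]]] f11.
have [N NP] := congruence_kernel (finite_finset : finite_set (range s)) sM.
have fN g g' h h' : qproj N g = qproj N g' -> qproj N h = qproj N h' -> f g h = f g' h'.
  by move=> /qproj_eq/NP gg' /qproj_eq/NP hh'; apply: sf.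
pose r x := repr (pc_coord N x).
have rK x : qproj N (r x) = pc_coord N x by rewrite /qproj reprK.
pose fc x y := f (r x) (r y).
have fc_of g h : fc (pc_of g) (pc_of h) = f g h by apply: fN; rewrite rK pc_coord_of.
have fcZ : cocycle2 fc.
  move=> x y z; rewrite -[RHS](fZ (r x) (r y) (r z)).
  have rM u v : qproj N (r (u * v)) = qproj N (r u * r v).
    by rewrite rK pc_coordM qprojM !rK.
  by congr (_ (+) _ (+) _ (+) _); apply: fN; rewrite ?rM.
have fc11 : fc 1 1 = false by rewrite -(pc_of1 H) fc_of.
exists (NormalizedCocycle fcZ fc11), N; split=> // x x' y y' xx' yy'.
by apply: fN; rewrite !rK.
Qed.

(** The pull-back splits over the dense free group; the splitting function factors through a finite
    quotient, hence extends to the completion. *)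
Lemma profinite_cocycle_splits (X : choiceType) (H : groupType)
    (q : {multiplicative profinite_completion (free_group X) -> profinite_completion H})
    (f : normalized_cocycle (profinite_completion H)) (N : finite_index_normal H) :
  continuous q ->
  (forall x x' y y', pc_coord N x = pc_coord N x' -> pc_coord N y = pc_coord N y' ->
     f x y = f x' y') ->
  exists (M : finite_index_normal (free_group X)) (h : profinite_completion (free_group X) -> bool),
    (forall x y, pc_coord M x = pc_coord M y -> h x = h y) /\
    (forall x y, f (q x) (q y) = h x (+) h y (+) h (x * y)).
Proof.
move=> q_cont fN.
have [|h hP] := @free_cocycle_splits X _ (fun w => q (pc_of w)) f.
  by move=> u v; rewrite pc_ofM gmulfM.
(* Paired with the coordinate of the image at [N], [h] becomes compatible with products, since [f]
   depends only on these coordinates. *)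
pose s w := (pc_coord N (q (pc_of w)), h w).
have hM u v : h (u * v) = f (q (pc_of u)) (q (pc_of v)) (+) h u (+) h v.
  by rewrite hP; case: (h u); case: (h v); case: (h _).
have s_fin : finite_set (range s).
  apply: (@sub_finite_set _ _ ([set: finite_quotient N] `*` [set: bool])) => //.
  by apply: finite_setX; [exact: finite_indexP|exact: finite_finset].
have [|M MP] := congruence_kernel s_fin.
  move=> x x' y y' [xx' hxx'] [yy' hyy']; rewrite /s !pc_ofM !gmulfM !pc_coordM xx' yy'.
  by rewrite !hM hxx' hyy' (fN _ _ _ _ xx' yy').
pose r x := repr (pc_coord M x).
have rK x : qproj M (r x) = pc_coord M x by rewrite /qproj reprK.
have sE u v : qproj M u = qproj M v -> s u = s v by move=> /qproj_eq/MP.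
have qr x : pc_coord N (q (pc_of (r x))) = pc_coord N (q x).
  (* Continuity of [q] gives a level [K] controlling the coordinate of [q x] at [N]; below both [K]
     and [M], one word [w] approximates [x] for both purposes. *)
  have [K KP] := pc_nbhsE (q_cont x _ (pc_coord_nbhs N (q x))).
  have [L [LK LM]] := finite_index_cap K M.
  have [w xw] := qproj_surj (pc_coord L x).
  have <- : pc_coord N (q (pc_of w)) = pc_coord N (q x).
    by apply: (KP (pc_of w)); apply: (pc_coord_mono LK); rewrite xw.
  suff /sE[] : qproj M (r x) = qproj M w by [].
  by rewrite rK; apply: (pc_compat LM).
exists M, (fun x => h (r x)); split=> [x y xy|x y]; first by rewrite /r xy.
rewrite -(fN _ _ _ _ (qr x) (qr y)) hP; congr (_ (+) _).
have /sE[] // : qproj M (r x * r y) = qproj M (r (x * y)).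
by rewrite qprojM !rK.
Qed.

(** * Finite presentations and separated families of cocycles *)

Lemma not_finitely_presented (H : groupType) (f : nat -> H -> H -> bool) :
  (forall k, cocycle2 (f k)) -> (forall k, finite_level (f k)) ->
  (forall k, f k 1 1 = false) ->
  (forall k l, k < l -> ~ coboundary2 (fun x y => f k x y (+) f l x y)) ->
  ~ finitely_presented_profinite (profinite_completion H).
Proof.
move=> fZ fS f11 f_sep [n [q [r [q_cont q_surj q_ker]]]].
have /choice [h hP] : forall k, exists h : profinite_completion (free_group 'I_n) -> bool,
    exists (fc : normalized_cocycle (profinite_completion H)) M,
    [/\ forall x y, fc (pc_of x) (pc_of y) = f k x y,
        forall x y, pc_coord M x = pc_coord M y -> h x = h y &
        forall x y, fc (q x) (q y) = h x (+) h y (+) h (x * y)].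
  move=> k; have [fc [N [fcN fc_of]]] := cocycle_completion (fZ k) (fS k) (f11 k).
  have [M [h [hM hf]]] := profinite_cocycle_splits q_cont fcN.
  by exists h, fc, M; split.
(* Pigeonhole: the vectors of values at the relators lie in a finite set. *)
pose v k : (size r).-tuple bool := [tuple h k (tnth (in_tuple r) i) | i < size r].
have [k [l kl vkl]] : exists k, exists2 l, k < l & v k = v l.
  apply: contrapT => v_inj.
  have inj_v : injective v.
    move=> k l vkl; case: (ltngtP k l) => // kl; case: v_inj.
      by exists k, l.
    by exists l, k.
  have := leq_card (fun i : 'I_(#|{:(size r).-tuple bool}|).+1 => v i) _.
  by rewrite card_ord ltnn => /(_ (fun i j ij => val_inj (inj_v _ _ ij))).
have hr x : x \in r -> h k x = h l x.
  move=> /seq_tnthP[i ->]; have := congr1 (fun t => tnth t i) vkl.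
  by rewrite !tnth_mktuple.
have [fk [Mk [fk_of hMk hfk]]] := hP k; have [fl [Ml [fl_of hMl hfl]]] := hP l.
pose fd x y := fk x y (+) fl x y; pose hd x := h k x (+) h l x.
have hdf x y : fd (q x) (q y) = hd x (+) hd y (+) hd (x * y).
  by rewrite /fd hfk hfl /hd; do 6!case: (h _ _).
have q1 : q 1 = 1 by apply: (mulgI (q 1)); rewrite -gmulfM !mulg1.
have qV x : q x^-1 = (q x)^-1 by apply: (mulgI (q x)); rewrite -gmulfM !mulgV q1.
have fd1l x : fd 1 x = false by rewrite /fd !ncocycle_1l.
have fd1r x : fd x 1 = false by rewrite /fd !ncocycle_1r.
have hd1 : hd 1 = false.
  by have := hdf 1 1; rewrite q1 fd1l mulg1 addbb addFb => <-.
have hd_kerl x y : q x = 1 -> hd (x * y) = hd x (+) hd y.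
  by move=> qx; have := hdf x y; rewrite qx fd1l; case: (hd x); case: (hd y); case: (hd _).
have hd_kerr x y : q y = 1 -> hd (x * y) = hd x (+) hd y.
  by move=> qy; have := hdf x y; rewrite qy fd1r; case: (hd x); case: (hd y); case: (hd _).
have hd_ker x : q x = 1 -> hd x = false.
  (* On the kernel of [q], [hd] is a continuous homomorphism invariant under conjugation, so [A] is
     a closed normal subgroup; it contains the relators. *)
  move=> qx; pose A := [set x | q x = 1 /\ hd x = false].
  suff : closed_normal_closure [set` r] `<=` A.
    by move=> /(_ x); rewrite -q_ker => /(_ qx)[].
  move=> y; apply; split.
  - split; first split; first by split; rewrite ?q1.
      move=> a b [qa ha] [qb hb]; have qb' : q b^-1 = 1 by rewrite qV qb invg1.
      split; first by rewrite gmulfM qa qb' mulg1.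
      rewrite hd_kerl // ha; have := hd_kerl b b^-1 qb.
      by rewrite mulgV hd1 hb; case: (hd _).
    move=> a g [qa ha].
    have qJ : q (a ^ g) = 1 by rewrite conjgE !gmulfM qa mul1g -gmulfM mulVg q1.
    split=> //.
    have gag : g * a ^ g = a * g by rewrite conjgE mulVKg.
    have := congr1 hd gag; rewrite (hd_kerr _ _ qJ) (hd_kerl _ _ qa).
    by rewrite ha; case: (hd g); case: (hd _).
  - move=> x' Ax'; split.
      apply: pc_eqP => N.
      have [z [[qz _] /= <-]] := Ax' _ (q_cont x' _ (pc_coord_nbhs N (q x'))).
      by rewrite qz.
    have [z [[_ hz] [zk zl]]] := Ax' _ (filterI (pc_coord_nbhs Mk x') (pc_coord_nbhs Ml x')).
    by rewrite -hz /hd (hMk _ _ zk) (hMl _ _ zl).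
  - move=> z /= zr; split; last by rewrite /hd (hr _ zr) addbb.
    suff : (q @^-1` [set 1]) z by [].
    by rewrite q_ker => B [_ _]; apply.
have /choice [c cP] : forall g, exists x, q x = pc_of g.
  move=> g; have : range q (pc_of g) by rewrite q_surj.
  by move=> [x _ <-]; exists x.
apply: (f_sep k l kl); exists (hd \o c) => x y.
rewrite -fk_of -fl_of -[LHS]/(fd _ _) -!cP hdf /=; congr (_ (+) _).
(* [c x * c y] and [c (x * y)] differ by an element of the kernel of [q], where [hd] vanishes. *)
have qk : q ((c (x * y))^-1 * (c x * c y)) = 1.
  by rewrite gmulfM qV gmulfM !cP -pc_ofM mulVg.
by rewrite -[c x * c y](mulVKg (c (x * y))) hd_kerr // (hd_ker _ qk) addbF.
Qed.

(** * The second cohomology group *)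

Section CountableCohomology.
Local Open Scope ring_scope.
Variables (H : groupType) (L : finType) (s : L -> H) (n : nat).
Hypothesis s_gen : forall g : H, exists w : seq L, g = (\prod_(l <- w) s l)%g.
Notation Hc := (profinite_completion H).

(* A finite H-set with a base point, and a function of [n] of its points. *)
Definition cochain_code : Type :=
  {k : nat & ({ffun L -> {ffun 'I_k.+1 -> 'I_k.+1}} * 'I_k.+1 *
              {ffun {ffun 'I_n -> 'I_k.+1} -> 'F_2})%type}.
HB.instance Definition _ := Countable.on cochain_code.

Definition word_act k (p : {ffun L -> {ffun 'I_k.+1 -> 'I_k.+1}}) (o : 'I_k.+1) (w : seq L) :=
  foldr (fun l i => p l i) o w.

Definition codes (c : cochain_code) (f : cochain Hc 'F_2 n) : Prop :=
  let: existT k (p, o, t) := c in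
  forall u : 'I_n -> seq L,
    f (fun i => pc_of (\prod_(l <- u i) s l)%g) = t [ffun i => word_act p o (u i)].

(** A code fixes the values on words, which are dense, and a continuous cochain is determined by
    these. *)
Lemma codes_inj c (f f' : cochain Hc 'F_2 n) : continuous_cochain f -> continuous_cochain f' ->
  codes c f -> codes c f' -> f = f'.
Proof.
case: c => k [[p o] t] /continuous_cochain_coord[N fN] /continuous_cochain_coord[M fM] fc fc'.
have [K [KN KM]] := finite_index_cap N M.
apply/funext => x.
have /choice [u xu] i : exists w, pc_coord K (x i) = qproj K (\prod_(l <- w) s l)%g.
  by have [g ->] := qproj_surj (pc_coord K (x i)); have [w ->] := s_gen g; exists w.
rewrite (fN x (fun i => pc_of (\prod_(l <- u i) s l)%g)); last first.
  by move=> i; apply: (pc_coord_mono KN); rewrite xu.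
rewrite (fM x (fun i => pc_of (\prod_(l <- u i) s l)%g)); last first.
  by move=> i; apply: (pc_coord_mono KM); rewrite xu.
by rewrite fc fc'.
Qed.

(** The finite set is a quotient [H / N] determining [f], based at 1; the table evaluates [f] at
    coset representatives. *)
Lemma continuous_cochain_codes (f : cochain Hc 'F_2 n) : continuous_cochain f ->
  exists c, codes c f.
Proof.
move=> /continuous_cochain_coord[N fN].
have /finite_seqP[e eE] := finite_indexP N.
have e_all (x : quotient_group N) : x \in e by have : [set` e] x; [rewrite -eE|].
(* Indices stay below [k]; the spare point of ['I_k.+1] only provides the type that [inord]
   expects. *)
pose k := size e; pose idx (x : quotient_group N) : 'I_k.+1 := inord (index x e).
have idxK x : nth 1%g e (idx x) = x.
  by rewrite inordK ?nth_index // ltnW // ltnS index_mem.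
pose p := [ffun l => [ffun i : 'I_k.+1 => idx (qproj N (s l) * nth 1%g e i)%g]] :
  {ffun L -> {ffun 'I_k.+1 -> 'I_k.+1}}.
pose t := [ffun v : {ffun 'I_n -> 'I_k.+1} => f (fun i => pc_of (repr (nth 1%g e (v i))))].
exists (existT _ k (p, idx 1%g, t)) => u; rewrite ffunE; apply: fN => i.
rewrite !pc_coord_of ffunE.
have -> : word_act p (idx 1%g) (u i) = idx (qproj N (\prod_(l <- u i) s l)%g).
  elim: (u i) => [|l w IH]; first by rewrite big_nil qproj1.
  by rewrite big_cons qprojM /= IH !ffunE idxK.
by rewrite idxK /qproj reprK.
Qed.

Lemma cohomology_countable :
  exists e : nat -> cohomology Hc 'F_2 n, forall u, exists m, e m = u.
Proof.
have F2 : forall c, exists u : cohomology Hc 'F_2 n,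
    forall z : cocycle Hc 'F_2 n, codes c (val z) -> \pi_(cohomology Hc 'F_2 n)%qT z = u.
  move=> c; have [[z zc]|no] := pselect (exists z : cocycle Hc 'F_2 n, codes c (val z)); last first.
    (* A code of no cocycle receives the class 0. *)
    by exists 0 => z zc; case: no; exists z.
  exists (\pi_(cohomology Hc 'F_2 n)%qT z) => z' zc'.
  congr (\pi_(cohomology Hc 'F_2 n)%qT _); apply/val_inj.
  have [cz _] := set_mem (valP z); have [cz' _] := set_mem (valP z').
  exact: codes_inj zc' zc.
have /choice [d dP] := F2.
exists (fun m => if unpickle m is Some c then d c else 0) => u.
pose z := repr u; have [cz _] := set_mem (valP z).
have [c zc] := continuous_cochain_codes cz.
by exists (pickle c); rewrite pickleK -(dP _ _ zc) reprK.
Qed.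

End CountableCohomology.

(** * Explicit coboundaries in degrees 1 and 2 *)

Section LowDegree.
Local Open Scope ring_scope.
Variables (G : topologicalGroup) (A : zmodType).

Definition pair2 (x y : G) : 'I_2 -> G := fun i => if i == ord0 then x else y.

Lemma pair2E (x : 'I_2 -> G) : x = pair2 (x ord0) (x (lift ord0 ord0)).
Proof.
apply/funext => i; rewrite /pair2; case: eqP => [->//|i0]; congr x.
by case: i i0 => -[|[|//]] i2 i0; [case: i0|]; exact/val_inj.
Qed.

Lemma coboundary1E (h : cochain G A 1) x y :
  coboundary h (pair2 x y) = h (fun=> y) - h (fun=> (x * y)%g) + h (fun=> x).
Proof.
rewrite /coboundary big_ord1 expr1 mulrN1z sqrrN expr1n mulr1z.
by congr (h _ - h _ + h _); apply/funext => i; rewrite ?ord1.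
Qed.

Lemma coboundary2E (h : cochain G A 2) (x : 'I_3 -> G) :
  let x0 := x ord0 in let x1 := x (lift ord0 ord0) in let x2 := x ord_max in
  coboundary h x = h (pair2 x1 x2) - h (pair2 (x0 * x1)%g x2)
    + h (pair2 x0 (x1 * x2)%g) - h (pair2 x0 x1).
Proof.
rewrite /= /coboundary !big_ord_recl big_ord0 addr0 expr1 mulrN1z sqrrN expr1n mulr1z.
rewrite [X in _ *~ X](_ : _ = -1) ?mulrN1z; last by rewrite exprS sqrrN expr1n mulr1.
rewrite -!addrA; congr (h _ + (- h _ + (h _ - h _))); rewrite [LHS]pair2E; congr (pair2 _ _);
  rewrite /contract /=; try congr (_ * _)%g; by congr (x _); apply/val_inj.
Qed.

End LowDegree.

(** * Infinitely many classes in degree 2 *)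

Section InfiniteCohomology.
Local Open Scope ring_scope.

Lemma natr_addb (a b : bool) : ((a (+) b)%:R : 'F_2) = a%:R + b%:R.
Proof. by apply/val_inj; case: a; case: b. Qed.

Lemma oppr_F2 (x : 'F_2) : - x = x.
Proof. by apply/val_inj; case: x => -[|[|//]]. Qed.

Lemma natr_neq0 (x : 'F_2) : (x != 0)%:R = x.
Proof. by apply/val_inj; case: x => -[|[|//]]. Qed.

Lemma natr_bool_inj (a b : bool) : (a%:R : 'F_2) = b%:R -> a = b.
Proof. by case: a; case: b => // /eqP. Qed.

Definition cochain_of_rel (G : topologicalGroup) (f : G -> G -> bool) : cochain G 'F_2 2 :=
  fun x => (f (x ord0) (x (lift ord0 ord0)))%:R.

Lemma coboundary_cochain_of_rel (G : topologicalGroup) (f : G -> G -> bool) :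
  cocycle2 f -> coboundary (cochain_of_rel f) = 0.
Proof.
move=> fZ; apply/funext => x; rewrite coboundary2E /cochain_of_rel /pair2 /=.
by rewrite !oppr_F2 -!natr_addb fZ.
Qed.

Variable H : groupType.
Notation Hc := (profinite_completion H).
Notation H2 := (cohomology Hc 'F_2 2).

Lemma cohomology_F2_double (u : H2) : u + u = 0.
Proof.
have uE : \pi_H2%qT (repr u) = u := reprK u.
have uuE : \pi_H2%qT (repr u + repr u) = u + u by rewrite -[in RHS]uE; exact: raddfD.
rewrite -uuE.
have -> : repr u + repr u = 0.
  apply/val_inj/funext => x; rewrite -[LHS]/(val (repr u) x + val (repr u) x).
  by rewrite -{1}[val _ x]oppr_F2 addNr.
exact: raddf0.
Qed.

(** The cocycles extend to the completion; a cochain splitting the difference of two extensions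
    would restrict along [pc_of] to a splitting on [H]. *)
Lemma cohomology_infinite (f : nat -> H -> H -> bool) :
  (forall k, cocycle2 (f k)) -> (forall k, finite_level (f k)) ->
  (forall k, f k 1%g 1%g = false) ->
  (forall k l, (k < l)%N -> ~ coboundary2 (fun x y => f k x y (+) f l x y)) ->
  infinite_set [set: H2].
Proof.
move=> fZ fS f11 f_sep.
have /choice [z zP] k : exists z : cocycle Hc 'F_2 2,
    forall x y, val z (pair2 (pc_of x) (pc_of y)) = (f k x y)%:R.
  have [fc [N [fcN fc_of]]] := cocycle_completion (fZ k) (fS k) (f11 k).
  have mem : cocycle_set (cochain_of_rel fc).
    split; last exact/coboundary_cochain_of_rel/ncocycleP.
    apply: (@coord_continuous_cochain _ _ _ N) => x y xy.
    by rewrite /cochain_of_rel (fcN _ _ _ _ (xy _) (xy _)).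
  exists (exist [in @cocycle_set Hc 'F_2 2] _ (mem_set mem)) => x y.
  by rewrite /= /cochain_of_rel /pair2 /= fc_of.
have z_sep k l : (k < l)%N -> \pi_H2%qT (z k) <> \pi_H2%qT (z l).
  move=> kl /eqP; rewrite -Quotient.idealrBE => /asboolP[h _ hE].
  apply: (f_sep k l kl); exists (fun x => h (fun=> pc_of x) != 0) => x y.
  apply: natr_bool_inj; rewrite !natr_addb !natr_neq0 -!zP.
  have := congr1 (fun F => F (pair2 (pc_of x) (pc_of y))) hE.
  rewrite coboundary1E -pc_ofM -[LHS]/(val (z k) _ - val (z l) _) !oppr_F2 => ->.
  by rewrite addrC addrA.
have z_inj : injective (fun k => \pi_H2%qT (z k)).
  by move=> k l zkl; case: (ltngtP k l) => // kl; have := z_sep _ _ kl; rewrite zkl.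
move=> H2_fin; apply: infinite_nat.
by apply: (@finite_preimage _ _ setT (fun k => \pi_H2%qT (z k))) H2_fin => k l _ _ /z_inj.
Qed.

End InfiniteCohomology.

Theorem theorem5 :
  zmod_isomorphic (cohomology (profinite_completion grigorchuk) 'F_2 2)
                  (direct_sum nat 'Z_2) /\
  ~ finitely_presented_profinite (profinite_completion grigorchuk).
Proof.
split; last exact: (not_finitely_presented carry_cocycleP carry_cocycle_finite_level
  carry_cocycle11 carry_cocycle_separated).
have [e e_surj] := cohomology_countable 2 ev_surj.
apply: (countable_elementary_abelian _ e_surj); first exact: cohomology_F2_double.
exact: (cohomology_infinite carry_cocycleP carry_cocycle_finite_level
  carry_cocycle11 carry_cocycle_separated).
Qed.
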